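(* Let $\Sigma$ and $\Omega$ be finite sets. The set of hypotheses $\mathcal{H}_{\mathrm{katf}}$ over the alphabet $\Sigma_{\mathrm{katf}}=\Sigma\uplus T_{\mathrm{BA}}\uplus\{\mathsf{F}\}$ reduces to the empty set; moreover $\mathsf{KA}_{\mathcal{H}_{\mathrm{katf}}}$ is complete, and the relation $\{(e,f)\mid \mathsf{KA}_{\mathcal{H}_{\mathrm{katf}}}\vdash e=f\}$ is decidable.
   Context: Regular expressions $T(X)$ over an alphabet $X$: $e,f::=e+f\mid e\cdot f\mid e^*\mid 0\mid 1\mid a$ ($a\in X$), with usual language $\llbracket e\rrbracket$. Kleene algebra axioms: idempotent semiring axioms plus $1+xx^*\le x^*$, $x+yz\le z\Rightarrow y^*x\le z$, $x+yz\le y\Rightarrow xz^*\le y$. A hypothesis is a pair $e\le f$; an equation as hypothesis stands for two inequations. $\mathsf{KA}_H\vdash e=f$ means derivable in equational logic from all instances of the Kleene algebra axioms and the hypotheses in $H$, letters being constants (no substitution rule); $\mathsf{KA}_H\vdash H'$ means $\mathsf{KA}_H\vdash e\le f$ for all $e\le f\in H'$. The $H$-closure $H^\star(L)$ is the smallest language containing $L$ such that for all $e\le f\in H$ and words $u,v$, $u\llbracket f\rrbracket v\subseteq H^\star(L)$ implies $u\llbracket e\rrbracket v\subseteq H^\star(L)$. $\mathsf{KA}_H$ is complete if $H^\star(\llbracket e\rrbracket)=H^\star(\llbracket f\rrbracket)$ implies $\mathsf{KA}_H\vdash e=f$. For $\Gamma\subseteq\Sigma'$, $H$ over $\Sigma'$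 and $H'$ over $\Gamma$, $H$ reduces to $H'$ if $\mathsf{KA}_H\vdash H'$ and there is a map $r:T(\Sigma')\to T(\Gamma)$ such that for all $e$, $\mathsf{KA}_H\vdash e=r(e)$ and $H^\star(\llbracket e\rrbracket)\cap\Gamma^*\subseteq H'^\star(\llbracket r(e)\rrbracket)$; ''reduces to the empty set'' means $H'=\emptyset$ for some such $\Gamma$. $T_{\mathrm{BA}}$ is the set of Boolean expressions over $\Omega$ (connectives $\vee,\wedge,\neg,\bot,\top$), each a single letter; $\mathsf{F}$ is a further letter. $\mathcal{H}_{\mathrm{kat}}=\mathcal{H}_{\mathrm{bool}}\cup\{\phi\wedge\psi=\phi\cdot\psi,\ \phi\vee\psi=\phi+\psi\mid\phi,\psi\in T_{\mathrm{BA}}\}\cup\{\bot=0,\top=1\}$ with $\mathcal{H}_{\mathrm{bool}}$ the set of all instances of Boolean algebra axioms over $T_{\mathrm{BA}}$. $\mathcal{H}_{\mathrm{full}}=\{e\le\mathsf{F}\mid e\in T(\Sigma_{\mathrm{katf}})\}\cup\{e\le e\cdot\mathsf{F}\cdot e\mid e\in T(\Sigma_{\mathrm{katf}})\}$ and $\mathcal{H}_{\mathrm{katf}}=\mathcal{H}_{\mathrm{kat}}\cup\mathcal{H}_{\mathrm{full}}$. Atoms (complete conjunctions of literals over $\Omega$) are regarded as elements of $T_{\mathrm{BA}}$. *)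

(* Defs.v *)
From mathcomp Require Import all_boot.
From mathcomp Require Import boolp classical_sets.

Set Implicit Arguments.
Unset Strict Implicit.
Unset Printing Implicit Defensive.

Local Open Scope classical_set_scope.

(** * Regular expressions and languages *)

Inductive regex (X : Type) : Type :=
| Zero
| One
| Letter (a : X)
| Plus (e f : regex X)
| Dot (e f : regex X)
| Star (e : regex X).

Arguments Zero {X}.
Arguments One {X}.

Declare Scope regex_scope.
Delimit Scope regex_scope with RE.
Bind Scope regex_scope with regex.
Notation "0" := Zero : regex_scope.
Notation "1" := One : regex_scope.
Notation "e + f" := (Plus e f) : regex_scope.
Notation "e * f" := (Dot e f) : regex_scope.

Fixpoint map_regex (X Y : Type) (h : X -> Y) (e : regex X) : regex Y :=
  match e with
  | Zero => 0
  | One => 1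
  | Letter a => Letter (h a)
  | Plus e f => map_regex h e + map_regex h f
  | Dot e f => map_regex h e * map_regex h f
  | Star e => Star (map_regex h e)
  end.

Definition language (X : Type) := set (seq X).

Definition lang_cat (X : Type) (A B : language X) : language X :=
  [set u ++ v | u in A & v in B].

Definition lang_star (X : Type) (A : language X) : language X :=
  \bigcup_n iter n (lang_cat A) [set [::]].

Fixpoint lang (X : Type) (e : regex X) : language X :=
  match e with
  | Zero => set0
  | One => [set [::]]
  | Letter a => [set [:: a]]
  | Plus e f => lang e `|` lang f
  | Dot e f => lang_cat (lang e) (lang f)
  | Star e => lang_star (lang e)
  end.

(** * Kleene algebra with hypotheses *)

(** [H e f] means that the inequation [e <= f] belongs to [H]. *)
Definition hyps (X : Type) := regex X -> regex X -> Prop.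

Definition no_hyps (X : Type) : hyps X := fun _ _ => False.

Definition union_hyps (X : Type) (H K : hyps X) : hyps X :=
  fun e f => H e f \/ K e f.

(** The inequations induced by a set of equations. *)
Definition hyps_of_eqs (X : Type) (E : regex X -> regex X -> Prop) : hyps X :=
  fun e f => E e f \/ E f e.

Reserved Notation "H ⊢ x ≡ y" (at level 70, x at level 69, y at level 69).
Reserved Notation "H ⊢ x ≦ y" (at level 70, x at level 69, y at level 69).

(** There is no substitution rule: letters are constants. *)
Inductive KA (X : Type) (H : hyps X) : regex X -> regex X -> Prop :=
| KA_refl x : H ⊢ x ≡ x
| KA_sym x y : H ⊢ x ≡ y -> H ⊢ y ≡ x
| KA_trans x y z : H ⊢ x ≡ y -> H ⊢ y ≡ z -> H ⊢ x ≡ z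
| KA_plus x x' y y' : H ⊢ x ≡ x' -> H ⊢ y ≡ y' -> H ⊢ (x + y) ≡ (x' + y')
| KA_dot x x' y y' : H ⊢ x ≡ x' -> H ⊢ y ≡ y' -> H ⊢ (x * y) ≡ (x' * y')
| KA_star x x' : H ⊢ x ≡ x' -> H ⊢ (Star x) ≡ (Star x')
| KA_plusA x y z : H ⊢ (x + (y + z)) ≡ ((x + y) + z)
| KA_plusC x y : H ⊢ (x + y) ≡ (y + x)
| KA_plus0 x : H ⊢ (x + 0) ≡ x
| KA_plusxx x : H ⊢ (x + x) ≡ x
| KA_dotA x y z : H ⊢ (x * (y * z)) ≡ ((x * y) * z)
| KA_dot1x x : H ⊢ (1 * x) ≡ x
| KA_dotx1 x : H ⊢ (x * 1) ≡ x
| KA_dot0x x : H ⊢ (0 * x) ≡ 0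
| KA_dotx0 x : H ⊢ (x * 0) ≡ 0
| KA_dotDl x y z : H ⊢ ((x + y) * z) ≡ (x * z + y * z)
| KA_dotDr x y z : H ⊢ (x * (y + z)) ≡ (x * y + x * z)
| KA_star_unfold x : H ⊢ (1 + x * Star x) ≦ (Star x)
| KA_star_indl x y z : H ⊢ (x + y * z) ≦ z -> H ⊢ (Star y * x) ≦ z
| KA_star_indr x y z : H ⊢ (x + y * z) ≦ y -> H ⊢ (x * Star z) ≦ y
| KA_hyp e f : H e f -> H ⊢ e ≦ f
where "H ⊢ x ≡ y" := (KA H x y)
  and "H ⊢ x ≦ y" := (KA H (Plus x y) y).

Definition hyp_closed (X : Type) (H : hyps X) (M : language X) : Prop :=
  forall e f u v, H e f ->
    lang_cat (lang_cat [set u] (lang f)) [set v] `<=` M ->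
    lang_cat (lang_cat [set u] (lang e)) [set v] `<=` M.

Definition hyp_closure (X : Type) (H : hyps X) (L : language X) : language X :=
  smallest (hyp_closed H) L.

Definition complete (X : Type) (H : hyps X) : Prop :=
  forall e f : regex X,
    hyp_closure H (lang e) = hyp_closure H (lang f) -> H ⊢ e ≡ f.

(** A subset [G] of the alphabet [X] is used as an alphabet through the
    coercion [set_type], and [T(G)] is embedded in [T(X)] by renaming letters
    along [sval]. *)
Definition embed (X : Type) (G : set X) : regex G -> regex X :=
  map_regex (fun a : G => sval a).

Definition reduces (X : Type) (G : set X) (H : hyps X) (H' : hyps G) : Prop :=
  (forall e f, H' e f -> H ⊢ embed e ≦ embed f) /\
  exists r : regex X -> regex G, forall e : regex X,
    H ⊢ e ≡ embed (r e) /\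
    (forall w : seq G, hyp_closure H (lang e) (map sval w) ->
       hyp_closure H' (lang (r e)) w).

Definition reduces_to_empty (X : Type) (H : hyps X) : Prop :=
  exists G : set X, reduces H (@no_hyps G).

(** * Kleene algebra with tests and a full element *)

Inductive bexp (Omega : Type) : Type :=
| BVar (o : Omega)
| BOr (p q : bexp Omega)
| BAnd (p q : bexp Omega)
| BNot (p : bexp Omega)
| BBot
| BTop.

Arguments BBot {Omega}.
Arguments BTop {Omega}.

(** Boolean algebras are axiomatised as complemented distributive lattices. *)
Inductive BA_axiom (Omega : Type) : bexp Omega -> bexp Omega -> Prop :=
| BA_orA p q r : BA_axiom (BOr p (BOr q r)) (BOr (BOr p q) r)
| BA_andA p q r : BA_axiom (BAnd p (BAnd q r)) (BAnd (BAnd p q) r)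
| BA_orC p q : BA_axiom (BOr p q) (BOr q p)
| BA_andC p q : BA_axiom (BAnd p q) (BAnd q p)
| BA_orK p q : BA_axiom (BOr p (BAnd p q)) p
| BA_andK p q : BA_axiom (BAnd p (BOr p q)) p
| BA_orDr p q r : BA_axiom (BOr p (BAnd q r)) (BAnd (BOr p q) (BOr p r))
| BA_andDr p q r : BA_axiom (BAnd p (BOr q r)) (BOr (BAnd p q) (BAnd p r))
| BA_or0 p : BA_axiom (BOr p BBot) p
| BA_and1 p : BA_axiom (BAnd p BTop) p
| BA_orN p : BA_axiom (BOr p (BNot p)) BTop
| BA_andN p : BA_axiom (BAnd p (BNot p)) BBot.

Inductive katf_letter (Sigma Omega : Type) : Type :=
| Act (a : Sigma)
| Test (p : bexp Omega)
| Full.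

Arguments Act {Sigma Omega}.
Arguments Test {Sigma Omega}.
Arguments Full {Sigma Omega}.

Section KATF.
Context (Sigma Omega : Type).

Local Notation T_katf := (regex (katf_letter Sigma Omega)).
Local Notation test p := (Letter (@Test Sigma Omega p)).
Local Notation F := (Letter (@Full Sigma Omega)).

Inductive kat_eqs : T_katf -> T_katf -> Prop :=
| kat_bool p q : BA_axiom p q -> kat_eqs (test p) (test q)
| kat_and p q : kat_eqs (test (BAnd p q)) (test p * test q)
| kat_or p q : kat_eqs (test (BOr p q)) (test p + test q)
| kat_bot : kat_eqs (test BBot) 0
| kat_top : kat_eqs (test BTop) 1.

Definition H_kat : hyps (katf_letter Sigma Omega) := hyps_of_eqs kat_eqs.

Inductive H_full : hyps (katf_letter Sigma Omega) :=
| full_top (e : T_katf) : H_full e F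
| full_mul (e : T_katf) : H_full e (e * F * e)%RE.

Definition H_katf : hyps (katf_letter Sigma Omega) := union_hyps H_kat H_full.

End KATF.

(** * Decidability *)

(** Logical decidability, or the existence of a boolean-valued Rocq function,
    would be vacuous under classical axioms. Decidability therefore refers to a
    fixed model of computation: first-order general recursive programs over
    S-expressions (as in McCarthy's recursion equations or Jones's language F),
    which is Turing complete. A program is a finite list of bodies of mutually
    recursive functions of one argument; function 0 is the entry point. *)

Inductive sexp : Type := SNil | SCons (s t : sexp).

Definition scar (s : sexp) : sexp := if s is SCons a _ then a else SNil.
Definition scdr (s : sexp) : sexp := if s is SCons _ b then b else SNil.

Inductive term : Type :=
| TArg
| TNil
| TCons (t1 t2 : term)
| TCar (t : term)
| TCdr (t : term)
| TIf (c t1 t2 : term)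
| TCall (k : nat) (t : term).

Definition program := seq term.

(** [eval P x t v]: in the program [P], when the argument of the current
    function is [x], the call-by-value evaluation of [t] terminates with value
    [v]. In conditionals, [SNil] is false and every pair is true. Undefined
    function names denote the constant function [SNil]. *)
Inductive eval (P : program) (x : sexp) : term -> sexp -> Prop :=
| eval_arg : eval P x TArg x
| eval_nil : eval P x TNil SNil
| eval_cons t1 t2 v1 v2 :
    eval P x t1 v1 -> eval P x t2 v2 -> eval P x (TCons t1 t2) (SCons v1 v2)
| eval_car t v : eval P x t v -> eval P x (TCar t) (scar v)
| eval_cdr t v : eval P x t v -> eval P x (TCdr t) (scdr v)
| eval_if_true c t1 t2 a b v :
    eval P x c (SCons a b) -> eval P x t1 v -> eval P x (TIf c t1 t2) v
| eval_if_false c t1 t2 v :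
    eval P x c SNil -> eval P x t2 v -> eval P x (TIf c t1 t2) v
| eval_call k t y v :
    eval P x t y -> eval P y (nth TNil P k) v -> eval P x (TCall k t) v.

Definition computes_to (P : program) (x v : sexp) : Prop :=
  eval P x (TCall 0 TArg) v.

Lemma eval_fun (P : program) (x : sexp) (t : term) (v w : sexp) :
  eval P x t v -> eval P x t w -> v = w.
Proof.
move=> ev; elim: ev w => {x t v} [x|x|x t1 t2 v1 v2 _ IH1 _ IH2|x t v _ IH
  |x t v _ IH|x c t1 t2 a b v _ IHc _ IH|x c t1 t2 v _ IHc _ IH
  |x k t y v _ IHy _ IH] w ew; inversion ew; subst=> //.
- by congr SCons; [exact: IH1|exact: IH2].
- by congr scar; exact: IH.
- by congr scdr; exact: IH.
- exact: IH.
- by have := IHc _ ltac:(eassumption).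
- by have := IHc _ ltac:(eassumption).
- exact: IH.
- by apply: IH; rewrite (IHy _ ltac:(eassumption)).
Qed.

Definition scode_nat (n : nat) : sexp := iter n (SCons SNil) SNil.

(** The node with constructor number [n] and list of arguments [l]. *)
Definition snode (n : nat) (l : seq sexp) : sexp :=
  SCons (scode_nat n) (foldr SCons SNil l).

(** Elements of a finite type are coded by their rank in its enumeration. *)
Definition scode_fin (T : finType) (x : T) : sexp := scode_nat (enum_rank x).

Fixpoint scode_bexp (Omega : finType) (p : bexp Omega) : sexp :=
  match p with
  | BVar o => snode 0 [:: scode_fin o]
  | BOr p q => snode 1 [:: scode_bexp p; scode_bexp q]
  | BAnd p q => snode 2 [:: scode_bexp p; scode_bexp q]
  | BNot p => snode 3 [:: scode_bexp p]
  | BBot => snode 4 [::]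
  | BTop => snode 5 [::]
  end.

Definition scode_letter (Sigma Omega : finType) (x : katf_letter Sigma Omega) :
    sexp :=
  match x with
  | Act a => snode 0 [:: scode_fin a]
  | Test p => snode 1 [:: scode_bexp p]
  | Full => snode 2 [::]
  end.

Fixpoint scode_regex (X : Type) (c : X -> sexp) (e : regex X) : sexp :=
  match e with
  | Zero => snode 0 [::]
  | One => snode 1 [::]
  | Letter a => snode 2 [:: c a]
  | Plus e f => snode 3 [:: scode_regex c e; scode_regex c f]
  | Dot e f => snode 4 [:: scode_regex c e; scode_regex c f]
  | Star e => snode 5 [:: scode_regex c e]
  end.

(** [R] is decidable, with respect to the coding [c] of the elements of [T]. *)
Definition decidable_rel (T : Type) (c : T -> sexp) (R : T -> T -> Prop) : Prop :=
  exists P : program, forall x y : T,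
    (R x y -> computes_to P (SCons (c x) (c y)) (SCons SNil SNil)) /\
    (~ R x y -> computes_to P (SCons (c x) (c y)) SNil).

(* Main.v *)
(** A guarded word [a0 x1 a1 ... xk ak], with atoms [ai] and letters [xi] in
    [Sigma + F], is a relational model with positions [0 .. k] in which [F] is the
    full relation. The words all of whose models [om] relate their endpoints by
    [e] form a closed language containing [lang e], so this language contains the
    closure of [lang e].

    A run of [e] in such a model alternates local runs along factors of the word
    with jumps along [F]. Which pairs of states are related by local runs along
    the whole word, a prefix, a suffix or a factor is computed by a finite
    deterministic automaton, so the expressions [G] of the words with a given
    accepting summary are regular, and [e <= e F e] gives [G <= G F G ... F G <=
      e].
    Ranging over all the guarded refinements of a word, this yields an expression
    over [Sigma], [F] and the atoms that is equal to [e] modulo the hypotheses and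
    denotes the closure of [lang e]. The inclusions of languages met on the way
      are
    turned into derivations by the completeness of Kleene algebra, obtained from
    the matrices of deterministic automata: if [E S S'] is the expression of the
    words leading from [S] to [S'] in a determinised automaton of [f], then [e] is
    below the sum of the [E S0 S'] with [S'] reachable through [lang e], and
    [E S S' * x S' <= x S] for the sums of states [x S].

    Finally, two expressions are equal if and only if they agree on all models of
    at most as many positions as there are pairs of summaries, which is checked by
    brute force. *)

Require Import Defs.
From Stdlib Require Import Setoid Morphisms.
From HB Require Import structures.
From mathcomp Require Import all_boot.
From mathcomp Require Import boolp classical_sets.

Set Implicit Arguments.
Unset Strict Implicit.
Unset Printing Implicit Defensive.

Local Open Scope classical_set_scope.
Local Open Scope regex_scope.

(** * Laws of Kleene algebra *)

Definition kle (X : Type) (H : hyps X) (x y : regex X) := H ⊢ x ≦ y.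

#[local] Hint Resolve KA_refl : core.

Lemma KA_equivalence (X : Type) (H : hyps X) : Equivalence (KA H).
Proof. by split; [exact: KA_refl|exact: KA_sym|exact: KA_trans]. Qed.
#[local] Existing Instance KA_equivalence.

Lemma Plus_proper (X : Type) (H : hyps X) :
  Proper (KA H ==> KA H ==> KA H) (@Plus X).
Proof. by move=> x x' xx' y y' yy'; exact: KA_plus. Qed.
#[local] Existing Instance Plus_proper.

Lemma Dot_proper (X : Type) (H : hyps X) :
  Proper (KA H ==> KA H ==> KA H) (@Dot X).
Proof. by move=> x x' xx' y y' yy'; exact: KA_dot. Qed.
#[local] Existing Instance Dot_proper.

Lemma Star_proper (X : Type) (H : hyps X) : Proper (KA H ==> KA H) (@Star X).
Proof. by move=> x x' xx'; exact: KA_star. Qed.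
#[local] Existing Instance Star_proper.

Lemma kle_preorder (X : Type) (H : hyps X) : PreOrder (kle H).
Proof.
rewrite /kle; split=> [x|x y z xy yz]; first exact: KA_plusxx.
by rewrite -{1}yz KA_plusA xy.
Qed.
#[local] Existing Instance kle_preorder.

Lemma kle_proper (X : Type) (H : hyps X) :
  Proper (KA H ==> KA H ==> iff) (kle H).
Proof. by move=> x x' xx' y y' yy'; rewrite /kle xx' yy'; split. Qed.
#[local] Existing Instance kle_proper.

Lemma kle_refl (X : Type) (H : hyps X) x : kle H x x.
Proof. exact: KA_plusxx. Qed.
#[local] Hint Resolve kle_refl : core.

Lemma KA_kle (X : Type) (H : hyps X) : subrelation (KA H) (kle H).
Proof. by move=> x y xy; rewrite /kle xy; exact: KA_plusxx. Qed.
#[local] Existing Instance KA_kle.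

Lemma Plus_mono (X : Type) (H : hyps X) :
  Proper (kle H ==> kle H ==> kle H) (@Plus X).
Proof.
rewrite /kle => x x' xx' y y' yy'.
suff -> : KA H (x + y + (x' + y')) ((x + x') + (y + y')) by rewrite xx' yy'.
by rewrite -!KA_plusA (KA_plusA H y) (KA_plusC H y x') -KA_plusA.
Qed.
#[local] Existing Instance Plus_mono.

Lemma Dot_mono (X : Type) (H : hyps X) :
  Proper (kle H ==> kle H ==> kle H) (@Dot X).
Proof.
rewrite /kle => x x' xx' y y' yy';
  apply: (@PreOrder_Transitive _ _ (kle_preorder H) _ (x * y')).
  by rewrite /kle -KA_dotDr yy'.
by rewrite /kle -KA_dotDl xx'.
Qed.
#[local] Existing Instance Dot_mono.

Section Laws.
Context (X : Type) (H : hyps X).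
Local Notation "x <== y" := (kle H x y) (at level 70).
Implicit Types x y z t : regex X.

Lemma kle_trans y x z : x <== y -> y <== z -> x <== z.
Proof. by move=> xy yz; transitivity y. Qed.

Lemma kle_anti x y : x <== y -> y <== x -> KA H x y.
Proof. by rewrite /kle => xy yx; rewrite -{1}yx KA_plusC. Qed.

Lemma kle0x x : 0 <== x.
Proof. by rewrite /kle KA_plusC KA_plus0. Qed.

Lemma kle_plusl x y : x <== x + y.
Proof. by rewrite /kle KA_plusA KA_plusxx. Qed.

Lemma kle_plusr x y : y <== x + y.
Proof. by rewrite KA_plusC; exact: kle_plusl. Qed.

Lemma kle_lub x y z : x <== z -> y <== z -> x + y <== z.
Proof. by move=> xz yz; rewrite -(KA_plusxx H z); apply: Plus_mono. Qed.

Lemma kle_dot x x' y y' : x <== x' -> y <== y' -> x * y <== x' * y'.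
Proof. by move=> xx' yy'; apply: Dot_mono. Qed.

Lemma star_unfold x : 1 + x * Star x <== Star x.
Proof. exact: KA_star_unfold. Qed.

Lemma kle_1star x : 1 <== Star x.
Proof. exact: kle_trans (kle_plusl _ _) (star_unfold x). Qed.

Lemma kle_starS x : x * Star x <== Star x.
Proof. exact: kle_trans (kle_plusr _ _) (star_unfold x). Qed.

Lemma star_indl x y z : x <== z -> y * z <== z -> Star y * x <== z.
Proof. by move=> xz yzz; apply: KA_star_indl; exact: kle_lub. Qed.

Lemma star_indr x y z : x <== y -> y * z <== y -> x * Star z <== y.
Proof. by move=> xy yzy; apply: KA_star_indr; exact: kle_lub. Qed.

Lemma star_ind1 y z : 1 <== z -> z * y <== z -> Star y <== z.
Proof. by move=> z1 zy; rewrite -(KA_dot1x H (Star y)); exact: star_indr. Qed.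

Lemma star_star x : Star x * Star x <== Star x.
Proof. by apply: star_indl => //; exact: kle_starS. Qed.

Lemma kle_xstar x : x <== Star x.
Proof.
rewrite -{1}(KA_dotx1 H x); apply: kle_trans (kle_starS x).
by apply: kle_dot; last exact: kle_1star.
Qed.

End Laws.

Arguments kle_trans {X H} y {x z}.

Definition ksum (X T : Type) (s : seq T) (F : T -> regex X) : regex X :=
  foldr (fun i e => F i + e) 0 s.

Section Sums.
Context (X : Type) (H : hyps X).
Local Notation "x <== y" := (kle H x y) (at level 70).
Implicit Types x y z t : regex X.

Lemma ksum_lub (T : eqType) (s : seq T) (F : T -> regex X) x :
  (forall i, i \in s -> F i <== x) -> ksum s F <== x.
Proof.
elim: s => [|i s IH] Fx /=; first exact: kle0x.
apply: kle_lub; first by apply: Fx; rewrite inE eqxx.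
by apply: IH => j js; apply: Fx; rewrite inE js orbT.
Qed.

Lemma kle_ksum (T : eqType) (s : seq T) (F : T -> regex X) i :
  i \in s -> F i <== ksum s F.
Proof.
elim: s => //= j s IH; rewrite inE => /predU1P[->|/IH le_i].
  exact: kle_plusl.
exact: kle_trans le_i (kle_plusr _ _ _).
Qed.

Lemma ksum_dotl (T : Type) (s : seq T) (F : T -> regex X) x :
  KA H (ksum s F * x) (ksum s (fun i => F i * x)).
Proof. by elim: s => [|i s IH] /=; rewrite ?KA_dot0x // KA_dotDl IH. Qed.

Lemma ksum_dotr (T : Type) (s : seq T) (F : T -> regex X) x :
  KA H (x * ksum s F) (ksum s (fun i => x * F i)).
Proof. by elim: s => [|i s IH] /=; rewrite ?KA_dotx0 // KA_dotDr IH. Qed.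

End Sums.

Lemma lang_ksum (X : Type) (T : eqType) (s : seq T) (F : T -> regex X) w :
  lang (ksum s F) w <-> exists2 i, i \in s & lang (F i) w.
Proof.
elim: s => [|i s IH] /=; first by split=> // -[].
split=> [[Fw|/IH[j js Fw]]|[j]].
- by exists i; rewrite ?inE ?eqxx.
- by exists j; rewrite ?inE ?js ?orbT.
- rewrite inE => /predU1P[->|js] Fw; first by left.
  by right; apply/IH; exists j.
Qed.

Fixpoint ksubst (C X : Type) (s : C -> regex X) (e : regex C) : regex X :=
  match e with
  | Zero => 0
  | One => 1
  | Letter a => s a
  | Plus e f => ksubst s e + ksubst s f
  | Dot e f => ksubst s e * ksubst s f
  | Star e => Star (ksubst s e)
  end.

Lemma ksubst_Letter (X : Type) (e : regex X) : ksubst (@Letter X) e = e.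
Proof. by elim: e => //= [e -> f ->|e -> f ->|e ->]. Qed.

Lemma map_regexE (C X : Type) (h : C -> X) (e : regex C) :
  map_regex h e = ksubst (fun c => Letter (h c)) e.
Proof. by elim: e => //= [e -> f ->|e -> f ->|e ->]. Qed.

Lemma ksubst_ksum (C X T : Type) (s : C -> regex X) (r : seq T) F :
  ksubst s (ksum r F) = ksum r (fun i => ksubst s (F i)).
Proof. by elim: r => //= i r ->. Qed.

(** Letters are constants under hypotheses, so only hypothesis-free derivations survive
    substitution. This is how completeness over an auxiliary finite alphabet is exported to
    [H_katf]. *)
Lemma KA_ksubst (C X : Type) (H : hyps X) (s : C -> regex X) (e f : regex C) :
  KA (@no_hyps C) e f -> KA H (ksubst s e) (ksubst s f).
Proof.
elim=> //= {e f}; try by move=> *; constructor.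
all: try by move=> x y z _ xy _ yz; exact: KA_trans xy yz.
Qed.

Lemma kle_ksubst (C X : Type) (H : hyps X) (s : C -> regex X) (e f : regex C) :
  kle (@no_hyps C) e f -> kle H (ksubst s e) (ksubst s f).
Proof. exact: KA_ksubst. Qed.

(** * Soundness and matrices of automata *)

Lemma lang_star_nil (X : Type) (A : language X) : lang_star A [::].
Proof. by exists 0%N. Qed.

Lemma lang_star_cons (X : Type) (A : language X) u v :
  A u -> lang_star A v -> lang_star A (u ++ v).
Proof. by move=> Au [n _ nv]; exists n.+1 => //=; exists u => //; exists v. Qed.

Lemma lang_star_ind (X : Type) (A : language X) (P : seq X -> Prop) :
  P [::] -> (forall u v, A u -> lang_star A v -> P v -> P (u ++ v)) ->
  forall w, lang_star A w -> P w.
Proof.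
move=> P0 PS w [n _]; elim: n w => [|n IH] w /=; first by move->.
by move=> [u Au [v nv <-]]; apply: PS => //; [exists n|exact: IH].
Qed.

(** Soundness is phrased through contexts: an inequation [e <= f] becomes the claim that every
    context [u], [v] fitting [f] also fits [e]. Quantifying over contexts makes this stable under
    products and stars. *)
Definition fits (X : Type) (M : language X) (u v : seq X) (e : regex X) :=
  forall w, lang e w -> M (u ++ w ++ v).

Section Soundness.
Context (X : Type) (M : language X).
Implicit Types (e f x y z : regex X) (u v w : seq X).

Lemma fits_plus u v e f : fits M u v (e + f) <-> fits M u v e /\ fits M u v f.
Proof.
split=> [Mef|[Me Mf] w [/Me|/Mf]] //.
by split=> w ew; apply: Mef; [left|right].
Qed.

Lemma fits_dotl u v e f :
  fits M u v (e * f) <-> forall w, lang e w -> fits M (u ++ w) v f.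
Proof.
split=> [Mef w ew w' fw'|Mef _ [w ew [w' fw' <-]]].
  by rewrite -catA (catA w); apply: Mef; exists w => //; exists w'.
by rewrite -catA catA; exact: Mef.
Qed.

Lemma fits_dotr u v e f :
  fits M u v (e * f) <-> forall w, lang f w -> fits M u (w ++ v) e.
Proof.
split=> [Mef w fw w' ew'|Mef _ [w ew [w' fw' <-]]].
  by rewrite (catA w'); apply: Mef; exists w' => //; exists w.
by rewrite -catA; exact: Mef.
Qed.

Lemma fits_starS u v e : fits M u v (Star e) -> fits M u v (e * Star e).
Proof.
by move=> Me _ [w ew [w' ew' <-]]; apply: Me; exact: lang_star_cons.
Qed.

(** The blocks of a word of [Star y] are moved one at a time into the left context, which keeps
    fitting [z] by the second hypothesis. *)
Lemma fits_star_indl x y z :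
  (forall u v, fits M u v z -> fits M u v x) ->
  (forall u v, fits M u v z -> fits M u v (y * z)) ->
  forall u v, fits M u v z -> fits M u v (Star y * x).
Proof.
move=> zx zyz u v Mz; apply/fits_dotl => w yw; apply: zx; elim/lang_star_ind:
  w / yw u Mz => [|w w' yw _ IH] u Mz; first by rewrite cats0.
by rewrite catA; apply: IH; exact: (fits_dotl _ _ _ _).1 (zyz _ _ Mz) _ yw.
Qed.

Lemma lang_star_rcons (A : language X) u v :
  lang_star A u -> A v -> lang_star A (u ++ v).
Proof.
move=> Au Av; elim/lang_star_ind: u / Au => [|u u' Au _ IH].
  by have := lang_star_cons Av (lang_star_nil A); rewrite cats0.
by rewrite -catA; exact: lang_star_cons.
Qed.

Lemma lang_star_rind (A : language X) (P : seq X -> Prop) :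
  P [::] -> (forall u v, lang_star A u -> A v -> P u -> P (u ++ v)) ->
  forall w, lang_star A w -> P w.
Proof.
move=> P0 PS w Aw; rewrite -[w]cat0s.
elim/lang_star_ind: w / Aw [::] (lang_star_nil A) P0 => [|w w' Aw _ IH] u Au Pu.
  by rewrite cats0.
by rewrite catA; apply: IH; [exact: lang_star_rcons|exact: PS].
Qed.

Lemma fits_star_indr x y z :
  (forall u v, fits M u v y -> fits M u v x) ->
  (forall u v, fits M u v y -> fits M u v (y * z)) ->
  forall u v, fits M u v y -> fits M u v (x * Star z).
Proof.
move=> yx yyz u v My; apply/fits_dotr => w zw; apply: yx; elim/lang_star_rind:
  w / zw v My => [|w w' _ zw IH] v My //.
by rewrite -catA; apply: IH; exact: (fits_dotr _ _ _ _).1 (yyz _ _ My) _ zw.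
Qed.

(** Left star induction with [Star y] as invariant: one block of [y] is traded for a block of [x]
    while the remaining iterations wait in the right context. *)
Lemma fits_star_mono x y :
  (forall u v, fits M u v y -> fits M u v x) ->
  forall u v, fits M u v (Star y) -> fits M u v (Star x).
Proof.
move=> yx u v My.
suff: fits M u v (Star x * Star y).
  move/fits_dotl => Mxy w xw; rewrite catA -[u ++ w]cats0 -catA -!catA.
  by rewrite catA; apply: (Mxy w xw [::]); exact: lang_star_nil.
apply: (@fits_star_indl _ _ (Star y)) => // u' v' My'; apply/fits_dotr => w yw.
by apply: yx; exact: (fits_dotr _ _ _ _).1 (fits_starS My') _ yw.
Qed.

Lemma KA_fits (H : hyps X) e f : hyp_closed H M -> KA H e f ->
  forall u v, fits M u v e <-> fits M u v f.
Proof.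
move=> HM; elim=> {e f}.
- by [].
- by move=> x y _ IH u v; rewrite IH.
- by move=> x y z _ IH1 _ IH2 u v; rewrite IH1.
- by move=> x x' y y' _ IH1 _ IH2 u v; rewrite !fits_plus IH1 IH2.
- move=> x x' y y' _ IH1 _ IH2 u v; rewrite fits_dotl.
  split=> [M1|/fits_dotr M1 w xw]; last by apply/IH2; apply/fits_dotl: w xw;
    apply/fits_dotr => w' yw'; apply/IH1; exact: M1.
  by apply/fits_dotr => w yw; apply/IH1; apply/fits_dotr: w yw;
    apply/fits_dotl => w' xw'; apply/IH2; exact: M1.
- by move=> x x' _ IH u v; split; apply: fits_star_mono => u' v' /IH.
- by move=> x y z u v; rewrite !fits_plus; tauto.
- by move=> x y u v; rewrite !fits_plus; tauto.
- by move=> x u v; rewrite !fits_plus; split=> [[]|Mx] //; split=> // w [].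
- by move=> x u v; rewrite !fits_plus; tauto.
- move=> x y z u v; rewrite !fits_dotl; split=> M1 w.
    by move=> [w1 xw1 [w2 yw2 <-]]; rewrite catA;
      exact: (fits_dotl _ _ _ _).1 (M1 _ xw1) _ yw2.
  by move=> xw; apply/fits_dotl => w' yw'; rewrite -catA; apply: M1;
    exists w => //; exists w'.
- move=> x u v; rewrite fits_dotl; split=> M1 w.
    by move=> xw; have := M1 [::] erefl w xw; rewrite cats0.
  by move=> -> ; rewrite cats0.
- move=> x u v; rewrite fits_dotr; split=> M1 w.
    by move=> xw; exact: M1 [::] erefl w xw.
  by move=> ->.
- by move=> x u v; split=> [_ w []|_]; apply/fits_dotl => w [].
- by move=> x u v; split=> [_ w []|_]; apply/fits_dotr => w [].
- move=> x y z u v; rewrite fits_plus !fits_dotr; split=> [M1|[M1 M2] w zw].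
    by split=> w /M1/fits_plus[].
  by apply/fits_plus; split; auto.
- move=> x y z u v; rewrite fits_plus !fits_dotl; split=> [M1|[M1 M2] w zw].
    by split=> w /M1/fits_plus[].
  by apply/fits_plus; split; auto.
- move=> x u v; rewrite !fits_plus; split=> [[]|Mx] //; split=> //; split.
    by move=> _ ->; apply: Mx; exact: lang_star_nil.
  exact: fits_starS.
- move=> x y z _ IH u v; rewrite fits_plus; split=> [[]|Mz] //; split=> //.
  have {}IH u' v' : fits M u' v' z -> fits M u' v' x /\ fits M u' v' (y * z).
    by move=> /IH/fits_plus[/fits_plus].
  by apply: (@fits_star_indl _ _ z) => // u' v' /IH[].
- move=> x y z _ IH u v; rewrite fits_plus; split=> [[]|Mz] //; split=> //.
  have {}IH u' v' : fits M u' v' y -> fits M u' v' x /\ fits M u' v' (y * z).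
    by move=> /IH/fits_plus[/fits_plus].
  by apply: (@fits_star_indr _ y) => // u' v' /IH[].
- move=> e f Hef u v; rewrite fits_plus; split=> [[]|Mf] //; split=> // w ew.
  rewrite catA; apply: (HM e f u v Hef); last first.
    by exists (u ++ w); [exists u => //; exists w|exists v].
  by move=> _ [_ [_ -> [w' fw' <-]] [_ -> <-]]; rewrite -catA; exact: Mf.
Qed.

Lemma kle_fits (H : hyps X) e f : hyp_closed H M -> kle H e f ->
  lang f `<=` M -> lang e `<=` M.
Proof.
move=> HM /(KA_fits HM) ef fM w ew; rewrite -[w]cats0.
have /ef/fits_plus[Me _] : fits M [::] [::] f.
  by move=> w' /fM; rewrite cats0.
exact: Me.
Qed.

End Soundness.

Lemma no_hyps_closed (X : Type) (M : language X) : hyp_closed (@no_hyps X) M.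
Proof. by []. Qed.

Lemma kle_lang (X : Type) (e f : regex X) :
  kle (@no_hyps X) e f -> lang e `<=` lang f.
Proof. by move/kle_fits; apply => //; exact: no_hyps_closed. Qed.

Lemma hyp_closureP (X : Type) (H : hyps X) (L : language X) :
  hyp_closed H (hyp_closure H L).
Proof.
move=> e f u v Hef cf w ew M [MH LM]; apply: (MH e f u v Hef) w ew => w fw.
exact: cf fw M (conj MH LM).
Qed.

Lemma kle_closure (X : Type) (H : hyps X) (e f : regex X) :
  kle H e f -> lang e `<=` hyp_closure H (lang f).
Proof.
move/kle_fits; apply; first exact: hyp_closureP.
by move=> w fw M [_]; exact.
Qed.

(** * Matrices of automata by state elimination *)

Section Kleene.
Context (Q C : finType) (step : Q -> C -> pred Q).

(** Kleene's construction: [K] lists the states allowed as intermediate states. The summand [1] on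
    the diagonal makes the matrix reflexive from the start. *)
Fixpoint kmat_via (K : seq Q) (p q : Q) : regex C :=
  match K with
  | [::] => (if p == q then 1 else 0) +
            ksum [seq c <- enum C | step p c q] (@Letter C)
  | r :: K => kmat_via K p q +
              kmat_via K p r * (Star (kmat_via K r r) * kmat_via K r q)
  end.

Definition kmat := kmat_via (enum Q).

Fixpoint run (p : Q) (w : seq C) (q : Q) : bool :=
  if w is c :: w then [exists r, step p c r && run r w q] else p == q.

Lemma run_cat p u v q :
  run p (u ++ v) q <-> exists2 r, run p u r & run r v q.
Proof.
elim: u p => [|c u IH] p /=; first by split=> [pq|[r /eqP->]] //; exists p.
split=> [/existsP[r /andP[pr /IH[r' rr' r'q]]]|[r' /existsP[r /andP[pr rr']
  r'q]]].
  by exists r' => //; apply/existsP; exists r; rewrite pr.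
by apply/existsP; exists r; rewrite pr; apply/IH; exists r'.
Qed.

Lemma run_rcons p u c q :
  run p (rcons u c) q <-> exists2 r, run p u r & step r c q.
Proof.
rewrite -cats1; split=> [/run_cat[r pr /= /existsP[r' /andP[rr' /eqP<-]]]|].
  by exists r.
move=> [r pr rq]; apply/run_cat; exists r => //=.
by apply/existsP; exists q; rewrite rq eqxx.
Qed.

Lemma lang_kmat_via K p q w : lang (kmat_via K p q) w -> run p w q.
Proof.
elim: K p q w => [|r K IH] p q w /= [].
- by case: eqP => [-> ->|_ []]; rewrite /= eqxx.
- move/lang_ksum => [c]; rewrite mem_filter => /andP[pq _] -> /=.
  by apply/existsP; exists q; rewrite pq eqxx.
- exact: IH.
move=> [u /IH pu [_ [v rv [v' /IH rv' <-]] <-]].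
apply/run_cat; exists r => //; apply/run_cat; exists r => //.
elim/lang_star_ind: v / rv => //= v1 v2 /IH rv1 _ rv2.
by apply/run_cat; exists r.
Qed.

Lemma lang_kmat p q w : lang (kmat p q) w -> run p w q.
Proof. exact: lang_kmat_via. Qed.

Section Laws.
Context (X : Type) (H : hyps X) (s : C -> regex X).
Local Notation "x <== y" := (kle H x y) (at level 70).
Local Notation E K p q := (ksubst s (kmat_via K p q)).

Lemma kmat_via_refl K p : 1 <== E K p p.
Proof.
elim: K => [|r K IH] /=; last by apply: kle_trans (kle_plusl _ _ _).
by rewrite eqxx; exact: kle_plusl.
Qed.

Lemma kmat_via_step K p c q : step p c q -> s c <== E K p q.
Proof.
move=> pq; elim: K => [|r K IH] /=; last by apply: kle_trans (kle_plusl _ _ _).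
apply: kle_trans (kle_plusr _ _ _); rewrite ksubst_ksum.
by apply: (@kle_ksum _ _ _ _ (fun c => s c)); rewrite mem_filter pq mem_enum.
Qed.

(** One elimination step of transitivity, with pivot loop [t]: the four hypotheses treat the four
    products according to which of the two paths visits the pivot. They also hold when the middle
    state is the pivot itself, where no induction hypothesis is available. *)
Lemma kmat_via_trans_aux a1 a2 a3 b1 b2 b3 t x (S := Star t) :
  a1 * b1 <== x + a2 * (S * b3) -> a1 * b2 <== a2 * S -> a3 * b1 <== S * b3 ->
  a3 * b2 <== S ->
  (a1 + a2 * (S * a3)) * (b1 + b2 * (S * b3)) <== x + a2 * (S * b3).
Proof.
move=> h11 h12 h31 h32; set T := x + _.
have SS y : S * (S * y) <== S * y.
  by rewrite KA_dotA; apply: kle_dot => //; exact: star_star.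
have aT : a2 * (S * b3) <== T by exact: kle_plusr.
rewrite KA_dotDl !KA_dotDr; do 2![apply: kle_lub => //].
- rewrite KA_dotA; apply: kle_trans aT; apply: kle_trans (kle_dot h12 _) _ => //.
  by rewrite -KA_dotA; exact: kle_dot.
- apply: kle_trans aT; rewrite -!KA_dotA; apply: kle_dot => //.
  by apply: kle_trans (SS b3); exact: kle_dot.
- apply: kle_trans aT; rewrite -!KA_dotA; apply: kle_dot => //.
  apply: kle_trans (SS b3); apply: kle_dot => //; rewrite KA_dotA.
  by apply: kle_trans (SS b3); exact: kle_dot.
Qed.

Lemma kmat_via_trans K p q r : r \in K -> E K p r * E K r q <== E K p q.
Proof.
elim: K p q r => //= t K IH p q r; rewrite inE.
case: (eqVneq r t) => [-> _|_ /= rK]; apply: kmat_via_trans_aux.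
- apply: kle_trans (kle_plusr _ _ _); apply: kle_dot => //.
  rewrite -{1}(KA_dot1x H (E K t q)); apply: kle_dot => //; exact: kle_1star.
- by apply: kle_dot => //; exact: kle_xstar.
- by apply: kle_dot => //; exact: kle_xstar.
- apply: kle_trans (star_star _ _).
  by apply: kle_dot; exact: kle_xstar.
- by apply: kle_trans (kle_plusl _ _ _); exact: IH.
- apply: kle_trans (IH _ _ _ rK) _; rewrite -{1}(KA_dotx1 H (E K p t)).
  by apply: kle_dot => //; exact: kle_1star.
- apply: kle_trans (IH _ _ _ rK) _; rewrite -{1}(KA_dot1x H (E K t q)).
  by apply: kle_dot => //; exact: kle_1star.
- by apply: kle_trans (IH _ _ _ rK) _; exact: kle_xstar.
Qed.

(** A family [y] closed under single steps is closed under whole paths: the star of each pivot is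
    eliminated by left star induction. This is the least-solution property of the linear system of
    the automaton. *)
Lemma kmat_via_left K (y : Q -> regex X) :
  (forall p c q, step p c q -> s c * y q <== y p) ->
  forall p q, E K p q * y q <== y p.
Proof.
move=> sy; elim: K => [|r K IH] p q /=; rewrite KA_dotDl; apply: kle_lub => //.
- by case: eqP => [->|_] /=; rewrite ?KA_dot1x ?KA_dot0x //; exact: kle0x.
- rewrite ksubst_ksum ksum_dotl; apply: ksum_lub => c.
  by rewrite mem_filter => /andP[/sy].
rewrite -!KA_dotA; apply: kle_trans (IH p r); apply: kle_dot => //.
apply: kle_trans (kle_dot (kle_refl _ _) (IH r q)) _.
by apply: star_indl => //; exact: IH.
Qed.

Lemma kmat_via_right K (z : Q -> regex X) :
  (forall p c q, step p c q -> z p * s c <== z q) ->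
  forall p q, z p * E K p q <== z q.
Proof.
move=> sz; elim: K => [|r K IH] p q /=; rewrite KA_dotDr; apply: kle_lub => //.
- by case: eqP => [->|_] /=; rewrite ?KA_dotx1 ?KA_dotx0 //; exact: kle0x.
- rewrite ksubst_ksum ksum_dotr; apply: ksum_lub => c.
  by rewrite mem_filter => /andP[/sz].
rewrite !KA_dotA; apply: kle_trans (IH r q); apply: kle_dot => //.
apply: kle_trans (kle_dot (IH p r) (kle_refl _ _)) _.
by apply: star_indr => //; exact: IH.
Qed.

Lemma kmat_refl p : 1 <== ksubst s (kmat p p).
Proof. exact: kmat_via_refl. Qed.

Lemma kmat_step p c q : step p c q -> s c <== ksubst s (kmat p q).
Proof. exact: kmat_via_step. Qed.

Lemma kmat_trans p q r :
  ksubst s (kmat p r) * ksubst s (kmat r q) <== ksubst s (kmat p q).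
Proof. by apply: kmat_via_trans; rewrite mem_enum. Qed.

Lemma kmat_left (y : Q -> regex X) :
  (forall p c q, step p c q -> s c * y q <== y p) ->
  forall p q, ksubst s (kmat p q) * y q <== y p.
Proof. exact: kmat_via_left. Qed.

Lemma kmat_right (z : Q -> regex X) :
  (forall p c q, step p c q -> z p * s c <== z q) ->
  forall p q, z p * ksubst s (kmat p q) <== z q.
Proof. exact: kmat_via_right. Qed.

End Laws.

(** Read off from the algebraic laws: they are instantiated without hypotheses and with the identity
    substitution, then interpreted in languages. *)
Lemma run_kmat p q w : run p w q -> lang (kmat p q) w.
Proof.
elim: w p => [|c w IH] p /= => [/eqP->|].
  by have /kle_lang := kmat_refl (@no_hyps C) (@Letter C) q;
    rewrite ksubst_Letter; apply.
move=> /existsP[r /andP[/(kmat_step (@no_hyps C)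
  (@Letter C))/kle_lang pr /IH rq]].
have /kle_lang := kmat_trans (@no_hyps C) (@Letter C) p q r.
rewrite !ksubst_Letter in pr * => pq; apply: pq; exists [:: c]; first exact: pr.
by exists w.
Qed.

End Kleene.

(** * Completeness of Kleene algebra *)

HB.instance Definition _ (X : Type) := gen_eqMixin (regex X).
HB.instance Definition _ (X : Type) := gen_choiceMixin (regex X).

(** Regular expressions are the states of a nondeterministic automaton with
    silent moves, labelled [None], and accepting state [1]. *)
Inductive sstep (X : Type) : regex X -> option X -> regex X -> Prop :=
| sstep_letter a : sstep (Letter a) (Some a) 1
| sstep_plusl e f : sstep (e + f) None e
| sstep_plusr e f : sstep (e + f) None f
| sstep_dot e e' f c : sstep e c e' -> sstep (e * f) c (e' * f)
| sstep_dot1 f : sstep (1 * f) None f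
| sstep_star0 e : sstep (Star e) None 1
| sstep_starS e : sstep (Star e) None (e * Star e).

Inductive srun (X : Type) : regex X -> seq X -> regex X -> Prop :=
| srun_nil q : srun q [::] q
| srun_step q c q1 w q' :
    sstep q c q1 -> srun q1 w q' -> srun q (seq_of_opt c ++ w) q'.

(** A finite set closed under [sstep]. In a product the left factor evolves until it is [1], after
    which [1 * f] moves silently to [f]. *)
Fixpoint states (X : Type) (e : regex X) : seq (regex X) :=
  e :: match e with
       | Letter _ => [:: 1]
       | Plus e f => states e ++ states f
       | Dot e f => [seq Dot q f | q <- states e] ++ states f
       | Star e' => 1 :: [seq Dot q e | q <- states e']
       | _ => [::]
       end.

Fixpoint rsize (X : Type) (e : regex X) : nat :=
  match e with
  | Letter _ => 2
  | Plus e f | Dot e f => (rsize e + rsize f).+1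
  | Star e => (rsize e).+2
  | _ => 1
  end.

Section SmallStep.
Context (X : Type).
Implicit Types (e f q : regex X) (w : seq X).

Lemma sstep_sound (H : hyps X) q c q' : sstep q c q' ->
  kle H (if c is Some a then Letter a * q' else q') q.
Proof.
elim=> {q c q'}.
- by move=> a; rewrite KA_dotx1.
- by move=> e f; exact: kle_plusl.
- by move=> e f; exact: kle_plusr.
- move=> e e' f [a|] _ IH; rewrite ?KA_dotA; exact: kle_dot.
- by move=> f; rewrite KA_dot1x.
- by move=> e; exact: kle_1star.
- by move=> e; exact: kle_starS.
Qed.

Lemma srun_cat q u q1 v q' : srun q u q1 -> srun q1 v q' -> srun q (u ++ v) q'.
Proof.
elim=> {q u q1} [q|q c q1 w q2 cq _ IH] //= /IH.
by rewrite -catA; exact: srun_step.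
Qed.

Lemma srun_dot e w e' f : srun e w e' -> srun (e * f) w (e' * f).
Proof.
elim=> {e w e'} [q|q c q1 w q' cq _]; first exact: srun_nil.
by apply: srun_step; exact: sstep_dot.
Qed.

Lemma srun_eps q q1 w q' : sstep q None q1 -> srun q1 w q' -> srun q w q'.
Proof. exact: srun_step. Qed.

Lemma lang_srun e w : lang e w -> srun e w 1.
Proof.
elim: e w => [||a|e IHe f IHf|e IHe f IHf|e IHe] w //=.
- by move=> ->; exact: srun_nil.
- by move=> ->; exact: (@srun_step _ _ (Some a) _ [::]) (sstep_letter a)
  (srun_nil _).
- move=> [/IHe|/IHf]; apply: srun_eps; first exact: sstep_plusl.
  exact: sstep_plusr.
- move=> [u /IHe eu [v /IHf fv <-]]; apply: srun_cat (srun_dot _ eu) _.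
  by apply: srun_eps fv; exact: sstep_dot1.
- elim/lang_star_ind => [|u v /IHe eu _ IH].
    by apply: srun_eps (srun_nil _); exact: sstep_star0.
  apply: srun_eps (sstep_starS _) _; apply: srun_cat (srun_dot _ eu) _.
  by apply: srun_eps IH; exact: sstep_dot1.
Qed.

Lemma mem_states e : e \in states e.
Proof. by case: e => *; rewrite inE eqxx. Qed.

Lemma states_closed e q c q' : q \in states e -> sstep q c q' -> q' \in states e.
Proof.
elim: e q q' => [||a|e IHe f IHf|e IHe f IHf|e IHe] q q' /=.
- by rewrite inE => /eqP-> cq; inversion cq.
- by rewrite inE => /eqP-> cq; inversion cq.
- rewrite !inE => /orP[] /eqP-> cq; inversion cq; subst.
  by rewrite eqxx orbT.
- rewrite !inE mem_cat => /or3P[/eqP->|eq|fq] cq.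
  + by inversion cq; subst; rewrite mem_cat mem_states ?orbT.
  + by rewrite mem_cat (IHe _ _ eq cq) orbT.
  + by rewrite mem_cat (IHf _ _ fq cq) !orbT.
(* Shared by the product itself and its left derivatives, all of the form [r * f]. *)
- have dotP r : r \in states e -> sstep (r * f) c q' ->
      q' \in [seq x * f | x <- states e] ++ states f.
    move=> er cr; inversion cr; subst; rewrite mem_cat.
      by rewrite map_f // (IHe _ _ er).
    by rewrite mem_states orbT.
  rewrite !inE mem_cat => /or3P[/eqP-> /dotP->|/mapP[r er ->] /dotP->|fq cq].
  + by rewrite orbT.
  + exact: mem_states.
  + by rewrite orbT.
  + by [].
  + by rewrite mem_cat (IHf _ _ fq cq) !orbT.
- rewrite !inE => /or3P[/eqP->|/eqP->|/mapP[r er ->]] cq.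
  + inversion cq; subst; rewrite ?eqxx ?orbT // map_f ?mem_states //.
    by rewrite !orbT.
  + by inversion cq.
  + inversion cq; subst; last by rewrite eqxx.
    by rewrite map_f ?orbT // (IHe _ _ er).
Qed.

Lemma srun_states e q w q' : q \in states e -> srun q w q' -> q' \in states e.
Proof. by move=> + qq'; elim: qq' =>
  // r c r1 v r' cr _ IH /states_closed/(_ cr). Qed.

Lemma size_states e : size (states e) = rsize e.
Proof.
by elim: e => //= [e <- f <-|e <- f <-|e <-]; rewrite ?size_cat ?size_map.
Qed.

End SmallStep.

Definition state (X : Type) (e : regex X) := seq_sub (undup (states e)).

HB.instance Definition _ (X : Type) (e : regex X) := Finite.on (state e).

Lemma card_state (X : Type) (e : regex X) : (#|{: state e}| <= rsize e)%N.
Proof.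
by rewrite -size_states card_seq_sub ?undup_uniq // size_undup.
Qed.

Definition to_state (X : Type) (e q : regex X) (eq : q \in states e) : state e :=
  SeqSub (etrans (mem_undup _ _) eq).

Lemma state_mem (X : Type) (e : regex X) (q : state e) : val q \in states e.
Proof. by rewrite -mem_undup; exact: valP. Qed.

Lemma sstep_state (X : Type) (e : regex X) (q : state e) c q' :
  sstep (val q) c q' -> exists r : state e, val r = q'.
Proof.
by move=> cq; exists (to_state (states_closed (state_mem q) cq)).
Qed.

(** A set [S] of states of [f] stands for the sum of its members. *)
Section Completeness.
Context (Y : finType) (f : regex Y).
Implicit Types (S : {set state f}) (w : seq Y).

(** Silent moves are absorbed before and after the letter. The initial set [det0] is not closed
    under them, whence the final silent run in [srun_det]. *)
Definition det (S : {set state f}) (a : Y) : {set state f} :=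
  [set q' | `[< exists2 q, q \in S & srun (val q) [:: a] (val q') >]].

Definition detsum (S : {set state f}) : regex Y := ksum (enum S) val.

Local Notation H := (@no_hyps Y).
Local Notation "x <== y" := (kle H x y) (at level 70).
Local Notation E := (kmat (fun S a S' => det S a == S')).

Lemma srun_sound q w q' : srun q w q' ->
  foldr (fun a e => Letter a * e) q' w <== q.
Proof.
elim=> {q w q'} // q c q1 w q' cq _ IH.
apply: kle_trans (sstep_sound H cq); case: c cq => [a|] _ //=.
exact: kle_dot.
Qed.

Lemma detsum_det S a : Letter a * detsum (det S a) <== detsum S.
Proof.
rewrite ksum_dotr; apply: ksum_lub => q'.
rewrite mem_enum inE => /asboolP[q qS /srun_sound aq].
by apply: kle_trans aq _; apply: kle_ksum; rewrite mem_enum.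
Qed.

Lemma srun_consP (q q' : regex Y) a w : srun q (a :: w) q' ->
  exists2 r, srun q [:: a] r & srun r w q'.
Proof.
move Ew: (a :: w) => v qq'; elim: qq' a w Ew =>
  // {}q c q1 {}v {}q' cq q1q' IH a w.
case: c cq => [b|] /= cq.
  move=> [-> ->]; exists q1 => //.
  exact: (@srun_step _ _ (Some _) _ [::]) cq (srun_nil _).
by move=> /IH[r q1r rq']; exists r => //; exact: srun_eps q1r.
Qed.

Lemma srun_det S (q : state f) w (q' : regex Y) : q \in S -> srun (val q) w q' ->
  exists2 r, r \in foldl det S w & srun (val r) [::] q'.
Proof.
elim: w S q => [|a w IH] S q qS; first by exists q.
move=> /srun_consP[r qr rq'] /=.
have rf := srun_states (state_mem q) qr.
by apply: (IH _ (to_state rf)) => //; rewrite inE; apply/asboolP; exists q.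
Qed.

Definition det0 : {set state f} := [set to_state (mem_states f)].

(** Induction on [g] for every start [S]: totality and determinism give each word a unique target,
    and products follow from transitivity of [E]. For a star, the whole sum is the invariant of
    right star induction. *)
Lemma lang_total (g : regex Y) S :
  g <== ksum [seq S' <- enum {set state f} |
              `[< exists2 w, lang g w & foldl det S w = S' >]] (fun S' => E S S').
Proof.
have inT (h : regex Y) R R' w : lang h w -> foldl det R w = R' ->
  R' \in [seq S' <- enum {set state f} |
      `[< exists2 w, lang h w & foldl det R w = S' >]].
  by move=> hw <-; rewrite mem_filter mem_enum andbT; apply/asboolP; exists w.
have E1 R : 1 <== E R R by have := kmat_refl (fun S a S' =>
  det S a == S') H (@Letter Y) R; rewrite ksubst_Letter.
elim: g S => [||a|g IHg h IHh|g IHg h IHh|g IHg] S.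
- exact: kle0x.
- exact: kle_trans (E1 S) (kle_ksum _ _ (inT 1 _ _ [::] erefl erefl)).
- apply: kle_trans _ (kle_ksum _ _ (inT (Letter a) S _ [:: a] erefl erefl)).
  have := @kmat_step _ _ (fun S a S' =>
    det S a == S') _ H (@Letter Y) S a _ (eqxx _).
  by rewrite ksubst_Letter.
- apply: kle_lub; [apply: kle_trans (IHg S) _|apply: kle_trans (IHh S) _].
    apply: ksum_lub => R; rewrite mem_filter => /andP[/asboolP[w gw wR] _].
    by apply: kle_ksum; apply: inT wR; left.
  apply: ksum_lub => R; rewrite mem_filter => /andP[/asboolP[w gw wR] _].
  by apply: kle_ksum; apply: inT wR; right.
- apply: kle_trans (kle_dot (IHg S) (kle_refl _ _)) _.
  rewrite ksum_dotl; apply: ksum_lub => R.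
  rewrite mem_filter => /andP[/asboolP[u gu uR] _].
  apply: kle_trans (kle_dot (kle_refl _ _) (IHh R)) _.
  rewrite ksum_dotr; apply: ksum_lub => R'.
  rewrite mem_filter => /andP[/asboolP[v hv vR'] _].
  have := kmat_trans (fun S a S' => det S a == S') H (@Letter Y) S R' R.
  rewrite !ksubst_Letter => /kle_trans; apply; apply: kle_ksum.
  by apply: (inT _ _ _ (u ++ v)); [exists u => //; exists v|rewrite foldl_cat uR].
- apply: star_ind1.
    apply: kle_trans (E1 S) (kle_ksum _ _ (inT (Star g) _ _ [::] _ erefl)).
    exact: lang_star_nil.
  rewrite ksum_dotl; apply: ksum_lub => R.
  rewrite mem_filter => /andP[/asboolP[u gu uR] _].
  apply: kle_trans (kle_dot (kle_refl _ _) (IHg R)) _.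
  rewrite ksum_dotr; apply: ksum_lub => R'.
  rewrite mem_filter => /andP[/asboolP[v hv vR'] _].
  have := kmat_trans (fun S a S' => det S a == S') H (@Letter Y) S R' R.
  rewrite !ksubst_Letter => /kle_trans; apply; apply: kle_ksum.
  by apply: (inT _ _ _ (u ++ v)); [exact: lang_star_rcons|rewrite foldl_cat uR].
Qed.

Theorem KA_complete (e : regex Y) : lang e `<=` lang f -> e <== f.
Proof.
move=> ef; apply: kle_trans (lang_total e det0) _.
apply: ksum_lub => S; rewrite mem_filter => /andP[/asboolP[w /ef fw wS] _].
(* The witness [w] belongs to [lang f], so some member of [S] reaches [1] silently. *)
have S1 : 1 <== detsum S.
  have /= := @srun_det det0 (to_state (mem_states f)) w 1.
  rewrite inE eqxx wS => /(_ isT (lang_srun fw))[r rS /srun_sound r1].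
  by apply: kle_trans r1 _; apply: kle_ksum; rewrite mem_enum.
have := @kmat_left _ _ (fun S a S' =>
  det S a == S') _ H (@Letter Y) detsum _ det0 S.
rewrite ksubst_Letter => El; rewrite -(KA_dotx1 H (E _ _)).
apply: kle_trans (kle_dot (kle_refl _ _) S1) _; apply: kle_trans (El _) _.
  by move=> R a _ /eqP<-; exact: detsum_det.
by apply: ksum_lub => q; rewrite mem_enum inE => /eqP->.
Qed.

End Completeness.

(** * Tests and atoms *)

Fixpoint beval (Omega : Type) (v : Omega -> bool) (p : bexp Omega) : bool :=
  match p with
  | BVar o => v o
  | BOr p q => beval v p || beval v q
  | BAnd p q => beval v p && beval v q
  | BNot p => ~~ beval v p
  | BBot => false
  | BTop => true
  end.

Section Tests.
Context (Sigma Omega : finType).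
Local Notation At := {ffun Omega -> bool}.
Local Notation X := (katf_letter Sigma Omega).
Local Notation H := (@H_katf Sigma Omega).
Local Notation tst p := (Letter (@Test Sigma Omega p)).
Local Notation F := (Letter (@Full Sigma Omega)).
Local Notation "x <== y" := (kle H x y) (at level 70).
Local Notation "x === y" := (KA H x y) (at level 70).
Implicit Types (p q : bexp Omega) (v : At) (e x y : regex X).

Definition literal (v : Omega -> bool) (o : Omega) : bexp Omega :=
  if v o then BVar o else BNot (BVar o).

Definition conjunction (l : seq Omega) (v : Omega -> bool) : bexp Omega :=
  foldr (fun o => BAnd (literal v o)) BTop l.

Definition atom v : bexp Omega := conjunction (enum Omega) v.

Lemma KA_kat e f : kat_eqs e f -> e === f.
Proof.
by move=> ef; apply: kle_anti; apply: KA_hyp; left; [left|right].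
Qed.

Lemma tst_and p q : tst (BAnd p q) === tst p * tst q.
Proof. by apply: KA_kat; exact: kat_and. Qed.

Lemma tst_or p q : tst (BOr p q) === tst p + tst q.
Proof. by apply: KA_kat; exact: kat_or. Qed.

Lemma tst_bot : tst BBot === 0.
Proof. by apply: KA_kat; exact: kat_bot. Qed.

Lemma tst_top : tst BTop === 1.
Proof. by apply: KA_kat; exact: kat_top. Qed.

Lemma tst_axiom p q : BA_axiom p q -> tst p === tst q.
Proof. by move=> pq; apply: KA_kat; exact: kat_bool. Qed.

Lemma tstC p q : tst p * tst q === tst q * tst p.
Proof. by rewrite -!tst_and; apply: tst_axiom; exact: BA_andC. Qed.

Lemma tst_idem p : tst p * tst p === tst p.
Proof.
have := tst_axiom (BA_andK p BBot); rewrite tst_and (tst_axiom (BA_or0 p)).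
exact.
Qed.

Lemma tst_orN p : tst p + tst (BNot p) === 1.
Proof. by rewrite -tst_or -tst_top; apply: tst_axiom; exact: BA_orN. Qed.

Lemma tst_andN p : tst p * tst (BNot p) === 0.
Proof. by rewrite -tst_and -tst_bot; apply: tst_axiom; exact: BA_andN. Qed.

Lemma tst_le1 p : tst p <== 1.
Proof. by rewrite -(tst_orN p); exact: kle_plusl. Qed.

Lemma conjunction_literal l v o : o \in l ->
  tst (conjunction l v) * tst (literal v o) === tst (conjunction l v).
Proof.
elim: l => //= o' l IH; rewrite inE => /predU1P[->|/IH ol].
  by rewrite tst_and -KA_dotA (tstC (conjunction l v)) KA_dotA tst_idem.
by rewrite tst_and -KA_dotA ol.
Qed.

(** An atom decides every test, so a test either preserves it or annihilates it. *)
Lemma atom_tst v p :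
  tst (atom v) * tst p === if beval v p then tst (atom v) else 0.
Proof.
elim: p => [o|p IHp q IHq|p IHp q IHq|p IH||] /=.
- have := conjunction_literal v (mem_enum Omega o); rewrite -/(atom v) /literal.
  case: (v o) => // no.
  by rewrite -no -KA_dotA (tstC (BNot _)) tst_andN KA_dotx0.
- rewrite tst_or KA_dotDr IHp IHq; case: (beval v p); case: (beval v q) => /=.
  + exact: KA_plusxx.
  + exact: KA_plus0.
  + by rewrite KA_plusC KA_plus0.
  + exact: KA_plus0.
- rewrite tst_and KA_dotA IHp; case: (beval v p) => //.
  by rewrite KA_dot0x.
(* The atom is split along [p] and its negation; the induction hypothesis erases one half, and when
   the atom lies below [p] the other half contains the product of [p] and its negation. *)
- have := KA_dotx1 H (tst (atom v)); rewrite -(tst_orN p) KA_dotDr IH.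
  case: (beval v p) IH => /= IH; last by rewrite KA_plusC KA_plus0.
  by rewrite -{4}IH -KA_dotA tst_andN KA_dotx0.
- by rewrite tst_bot KA_dotx0.
- by rewrite tst_top KA_dotx1.
Qed.

Lemma beval_conjunction l (u v : Omega -> bool) :
  beval u (conjunction l v) = all (fun o => u o == v o) l.
Proof.
elim: l => //= o l ->; congr andb; rewrite /literal.
by case: (v o) => /=; case: (u o).
Qed.

Lemma beval_atom (u v : At) : beval u (atom v) = (u == v).
Proof.
rewrite beval_conjunction; apply/allP/eqP => [uv|->] //.
by apply/ffunP => o; apply/eqP; rewrite uv ?mem_enum.
Qed.

Lemma atom_orth (u v : At) :
  tst (atom u) * tst (atom v) === if u == v then tst (atom u) else 0.
Proof. by rewrite atom_tst beval_atom. Qed.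

Lemma atom_le v p : beval v p -> tst (atom v) <== tst p.
Proof.
move=> vp; have := atom_tst v p; rewrite vp => <-.
rewrite -[X in _ <== X](KA_dot1x H); apply: kle_dot => //; exact: tst_le1.
Qed.

(** Excluded middle is applied to one variable at a time. Valuations stay defined on all of [Omega]
    even while the conjunction covers only a sublist. *)
Lemma tst_total : 1 <== ksum (enum {: At}) (fun v => tst (atom v)).
Proof.
rewrite /atom; elim: (enum Omega) (enum_uniq Omega) => [_|o l IH] /=.
  rewrite -tst_top; apply: (@kle_ksum _ H _ _ _ [ffun=> true]).
  by rewrite mem_enum.
move=> /andP[ol /IH{}IH]; apply: kle_trans IH _; apply: ksum_lub => v _.
(* Since [o] is not in [l], overwriting its value leaves the conjunction over [l] unchanged; the two
   choices of [b] supply the two literals. *)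
pose upd b : At := [ffun o' => if o' == o then b else v o'].
have updE b : conjunction l (upd b) = conjunction l v.
  elim: l ol => //= o' l IH; rewrite inE negb_or => /andP[oo' /IH->].
  by rewrite /literal ffunE eq_sym (negbTE oo').
rewrite -(KA_dot1x H (tst _)) -(tst_orN (BVar o)) KA_dotDl.
have inT b : upd b \in enum {: At} by rewrite mem_enum.
apply: kle_lub.
  have := kle_ksum H
    (fun v => tst (BAnd (literal v o) (conjunction l v))) (inT true).
  by rewrite updE /literal ffunE eqxx tst_and.
have := kle_ksum H
  (fun v => tst (BAnd (literal v o) (conjunction l v))) (inT false).
by rewrite updE /literal ffunE eqxx tst_and.
Qed.

Lemma tst_split p : tst p <== ksum [seq v : At <- enum {: At} | beval v p]
  (fun v : At => tst (atom v)).
Proof.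
rewrite -(KA_dot1x H (tst p)).
apply: kle_trans (kle_dot tst_total (kle_refl _ _)) _.
rewrite ksum_dotl; apply: ksum_lub => v _; rewrite atom_tst.
case: ifPn => [vp|_]; last exact: kle0x.
by apply: (kle_ksum H (fun v : At => tst (atom v)));
  rewrite mem_filter vp mem_enum.
Qed.

Lemma kleF e : e <== F.
Proof. by apply: KA_hyp; right; exact: full_top. Qed.

Lemma kle_mulF e : e <== e * F * e.
Proof. by apply: KA_hyp; right; exact: full_mul. Qed.

End Tests.

(** * Relational models *)

Section Models.
Context (Sigma Omega : finType).
Local Notation At := {ffun Omega -> bool}.
Local Notation X := (katf_letter Sigma Omega).
Local Notation H := (@H_katf Sigma Omega).
Implicit Types (e f : regex X) (v : At) (w : seq X).

(** A list [om] of pairs is the relational model with positions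
    [0 .. size om - 1]: the [i]-th pair holds the action leading from position
    [i - 1] to position [i], or [None], and the valuation at position [i]. *)
Definition node := (option Sigma * At)%type.
HB.instance Definition _ := Finite.on node.
Implicit Types (om s : seq node) (y : node).

Definition node0 : node := (None, [ffun=> false]).

Definition letter_rel om (x : X) (i j : nat) : bool :=
  match x with
  | Act a => [&& j == i.+1, j < size om & (nth node0 om j).1 == Some a]%N
  | Test p => [&& j == i, i < size om & beval (nth node0 om i).2 p]%N
  | Full => (i < size om) && (j < size om)%N
  end.

(** The empty word also relates positions outside the model to themselves, hence the range
    hypotheses in what follows. *)
Fixpoint word_rel om w (i j : nat) : Prop :=
  if w is x :: w then exists2 k, letter_rel om x i k & word_rel om w k j
  else i = j.

Definition regex_rel om e i j := exists2 w, lang e w & word_rel om w i j.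

Lemma letter_rel_gt om x i j : letter_rel om x i j -> (j < size om)%N.
Proof. by case: x => [a|p|] /= => [/and3P[_ ->]|/and3P[/eqP->]|/andP[_ ->]]. Qed.

Lemma word_rel_gt om w i j : (i < size om)%N -> word_rel om w i j ->
  (j < size om)%N.
Proof.
by elim: w i => [|x w IH] i //= lti => [<-|[k /letter_rel_gt/IH]] //; apply.
Qed.

Lemma word_rel_cat om u w i j :
  word_rel om (u ++ w) i j <-> exists2 k, word_rel om u i k & word_rel om w k j.
Proof.
elim: u i => [|x u IH] i /=; first by split=> [|[k ->]] //; exists i.
split=> [[k ik /IH[k' kk' k'j]]|[k' [k ik kk'] k'j]].
  by exists k' => //; exists k.
by exists k => //; apply/IH; exists k'.
Qed.

Lemma letter_rel_rcons om y x i j :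
  letter_rel om x i j -> letter_rel (rcons om y) x i j.
Proof.
case: x => [a|p|] /=; rewrite size_rcons.
- by move=> /and3P[-> lt]; rewrite nth_rcons lt ltnS (ltnW lt).
- by move=> /and3P[-> lt]; rewrite nth_rcons lt ltnS (ltnW lt).
- by move=> /andP[/ltnW + /ltnW]; rewrite !ltnS => -> ->.
Qed.

Lemma word_rel_rcons om y w i j :
  word_rel om w i j -> word_rel (rcons om y) w i j.
Proof.
elim: w i => //= x w IH i [k ik /IH kj]; exists k => //.
exact: letter_rel_rcons.
Qed.

Lemma regex_rel0 om i j : ~ regex_rel om 0 i j. Proof. by case. Qed.

Lemma regex_rel1 om i j : regex_rel om 1 i j <-> i = j.
Proof. by split=> [[_ ->]|ij] //; exists [::]. Qed.

Lemma regex_rel_letter om x i j :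
  regex_rel om (Letter x) i j <-> letter_rel om x i j.
Proof.
by split=> [[_ ->] [k ik <-]|ij] //; exists [:: x] => //; exists j.
Qed.

Lemma regex_rel_plus om e f i j :
  regex_rel om (e + f) i j <-> regex_rel om e i j \/ regex_rel om f i j.
Proof.
split=> [[w [ew|fw] ij]|[[w ew ij]|[w fw ij]]].
- by left; exists w.
- by right; exists w.
- by exists w => //; left.
- by exists w => //; right.
Qed.

Lemma regex_rel_dot om e f i j : regex_rel om (e * f) i j <->
  exists2 k, regex_rel om e i k & regex_rel om f k j.
Proof.
split=> [[_ [u eu [w fw <-]] /word_rel_cat[k ik kj]]|[k [u eu ik] [w fw kj]]].
  by exists k; [exists u|exists w].
by exists (u ++ w); [exists u => //; exists w|apply/word_rel_cat; exists k].
Qed.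

Lemma BA_axiom_beval (p q : bexp Omega) v : BA_axiom p q -> beval v p = beval v q.
Proof.
case=> {p q} *; rewrite /=;
  repeat match goal with |- context [beval ?u ?r] => case: (beval u r) end.
all: by [].
Qed.

Lemma kat_eqs_rel om e f i j : (i < size om)%N ->
  kat_eqs e f -> regex_rel om e i j <-> regex_rel om f i j.
Proof.
move=> lti; case=> {e f} [p q pq|p q|p q||].
- by rewrite !regex_rel_letter /= (BA_axiom_beval _ pq).
- rewrite regex_rel_dot !regex_rel_letter /=; split.
    move=> /and4P[/eqP-> _ vp vq]; exists i; apply/regex_rel_letter => /=.
      by rewrite eqxx lti.
    by rewrite eqxx lti.
  move=> [k /regex_rel_letter/and3P[/eqP-> _ vp]].
  by move=> /regex_rel_letter/and3P[/eqP-> _ vq]; rewrite eqxx lti vp.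
- rewrite regex_rel_plus !regex_rel_letter /= lti.
  case: eqP => _ /=; last by split=> [|[]].
  by split=> [/orP|[->|->]] //; rewrite ?orbT.
- by rewrite regex_rel_letter /= !andbF; split=> // /regex_rel0.
- rewrite regex_rel_letter regex_rel1 /= lti andbT.
  by rewrite eq_sym /= ?andbT; split=> /eqP.
Qed.

(** For [e <= e * F * e], the run from [i] to [j] is performed, [F] jumps back to [i], and the same
    run is repeated. *)
Lemma H_katf_rel om e f i j : (i < size om)%N ->
  H e f -> regex_rel om e i j -> regex_rel om f i j.
Proof.
move=> lti [[/(kat_eqs_rel j lti)[]|/(kat_eqs_rel j lti)[]]|] //.
case=> {e f} e [w ew ij]; have ltj := word_rel_gt lti ij.
  by apply/regex_rel_letter; rewrite /= lti.
apply/regex_rel_dot; exists i; last by exists w.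
apply/regex_rel_dot; exists j; first by exists w.
by apply/regex_rel_letter; rewrite /= lti ltj.
Qed.

Definition accepts e om := regex_rel om e 0 (size om).-1.

Definition model_lang e : language X := [set w |
  forall v s, word_rel ((None, v) :: s) w 0 (size s) ->
    accepts e ((None, v) :: s)].

Lemma lang_model e : lang e `<=` model_lang e.
Proof. by move=> w ew v s vs; exists w. Qed.

Lemma model_lang_closed e : hyp_closed H (model_lang e).
Proof.
move=> e1 f1 u1 u2 H1 Hf _ [_ [_ -> [w ew <-]] [_ -> <-]] v s.
set om := _ :: s => /word_rel_cat[j /word_rel_cat[i u1i wij] u2j].
have lti : (i < size om)%N by apply: word_rel_gt u1i.
(* Inside a fixed model the factor [w] of [e1] can be exchanged for some [w'] of [f1] with the same
   endpoints. *)
have [w' fw' w'ij] : regex_rel om f1 i j by apply: (H_katf_rel lti H1); exists w.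
apply: (Hf (u1 ++ w' ++ u2)).
  rewrite catA; exists (u1 ++ w'); last by exists u2.
  by exists u1 => //; exists w'.
apply/word_rel_cat; exists i => //; apply/word_rel_cat; exists j => //.
Qed.

Lemma kle_model e f : kle H f e -> lang f `<=` model_lang e.
Proof.
by move/kle_fits; apply; [exact: model_lang_closed|exact: lang_model].
Qed.

End Models.

(** * Local runs, jumps and summaries *)

Section Local.
Context (Sigma Omega : finType).
Local Notation At := {ffun Omega -> bool}.
Local Notation X := (katf_letter Sigma Omega).
Local Notation node := (node Sigma Omega).
Context (e : regex X).
Local Notation Q := (state e).
Implicit Types (q r : Q) (v : At) (om s : seq node) (y : node).

Inductive tmove v : regex X -> regex X -> Prop :=
| tmove_refl x : tmove v x x
| tmove_eps x x1 x' : sstep x None x1 -> tmove v x1 x' -> tmove v x x'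
| tmove_test x p x1 x' :
    sstep x (Some (Test p)) x1 -> beval v p -> tmove v x1 x' -> tmove v x x'.

Definition move q y q' : bool :=
  if y.1 is Some a then
    `[< exists2 q1, sstep (val q) (Some (Act a)) q1 & tmove y.2 q1 (val q') >]
  else false.

Definition jump q q' := sstep (val q) (Some Full) (val q').

(** A run from [q] to [q'] along a factor of [om] without [F]; if [b1] (resp.
    [b2]) holds, the factor is a prefix (resp. a suffix). *)
Definition segment om (b1 b2 : bool) q q' := exists s0 y q1 s1 s2,
  [/\ om = s0 ++ y :: s1 ++ s2, b1 -> s0 = [::], b2 -> s2 = [::],
      tmove y.2 (val q) (val q1) & run move q1 s1 q'].

(** The valuation is that of the last position; the set records which instances of [segment]
    hold. *)
Definition summary := (At * {set bool * bool * Q * Q})%type.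
HB.instance Definition _ := Finite.on summary.
Implicit Types psi : summary.

Definition summary0 v : summary :=
  (v, [set t | `[< tmove v (val t.1.2) (val t.2) >]]%SET).

Definition advance psi y : summary :=
  (y.2, [set t | let: (b1, b2, q, q') := t in
     [|| [exists r, ((b1, true, q, r) \in psi.2) && move r y q'],
         ~~ b1 && `[< tmove y.2 (val q) (val q') >] |
         ~~ b2 && ((b1, false, q, q') \in psi.2)]]%SET).

Definition summarize v s := foldl advance (summary0 v) s.

Lemma segment1 y b1 b2 q q' :
  segment [:: y] b1 b2 q q' <-> tmove y.2 (val q) (val q').
Proof.
split=> [[s0 [y' [q1 [s1 [s2 [+ _ _]]]]]]|qq'].
  case: s0 => [|? []] //= [<-].
  by case: s1 => //= _ qq1 /eqP<-.
by exists [::], y, q', [::], [::]; rewrite /= eqxx.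
Qed.

(** The new last position either extends the factor, or is the whole factor, or lies behind it. As
    [om] is nonempty, the second case cannot be a prefix. *)
Lemma segment_rcons om y b1 b2 q q' : om <> [::] ->
  segment (rcons om y) b1 b2 q q' <->
  [\/ exists2 r, segment om b1 true q r & move r y q',
      ~~ b1 /\ tmove y.2 (val q) (val q') | ~~ b2 /\ segment om b1 false q q'].
Proof.
move=> om0; split; last first.
  case=> [[r [s0 [y' [q1 [s1 [s2 [-> b1s0 b2s2 qq1 q1r]]]]]] ry]|[nb1 qq']|
          [nb2 [s0 [y' [q1 [s1 [s2 [-> b1s0 _ qq1 q1q']]]]]]]].
  - exists s0, y', q1, (rcons s1 y), [::]; split=> //.
      by rewrite (b2s2 isT) !cats0 -rcons_cons -rcons_cat.
    by apply/run_rcons; exists r.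
  - exists om, y, q', [::], [::]; split=> //=; first by rewrite cats1.
    by rewrite (negbTE nb1).
  - exists s0, y', q1, s1, (rcons s2 y); split=> //; last by rewrite (negbTE nb2).
    by rewrite -rcons_cat -rcons_cons -rcons_cat.
move=> [s0 [y' [q1 [s1 [s2 [+ b1s0 b2s2 qq1 q1q']]]]]].
case/lastP: s2 b2s2 => [_|s2 y2 b2s2]; last first.
  rewrite -rcons_cat -rcons_cons -rcons_cat => /rcons_inj[-> _].
  constructor 3; split; first by case: b2 b2s2 => // /(_ isT); case: s2.
  by exists s0, y', q1, s1, s2.
rewrite cats0; case/lastP: s1 q1q' => [/eqP q1q'|s1 y1].
  rewrite cats1 => /rcons_inj[oms0 yy']; constructor 2.
  split; last by rewrite yy' -q1q'.
  by apply/negP => /b1s0 s00; apply: om0; rewrite oms0.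
move=> /run_rcons[r q1r ry]; rewrite -rcons_cons -rcons_cat => /rcons_inj[-> ->].
constructor 1; exists r => //.
by exists s0, y', q1, s1, [::]; rewrite cats0.
Qed.

Lemma mem_summarize v s b1 b2 q q' :
  (b1, b2, q, q') \in (summarize v s).2 <->
  segment ((None, v) :: s) b1 b2 q q'.
Proof.
elim/last_ind: s b1 b2 q q' => [|s y IH] b1 b2 q q'.
  by rewrite segment1 /= inE; split=> /asboolP.
rewrite -rcons_cons segment_rcons // /summarize -cats1 foldl_cat /= inE
  -/(summarize v s).
split=> [/or3P[/existsP[r /andP[/IH qr ry]]|/andP[nb1 /asboolP qq']|
  /andP[nb2 /IH qq']]|[[r /IH qr ry]|[nb1 qq']|[nb2 /IH qq']]].
- by constructor 1; exists r.
- by constructor 2.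
- by constructor 3.
- by apply/or3P; constructor 1; apply/existsP; exists r; rewrite qr.
- by apply/or3P; constructor 2; rewrite nb1; apply/asboolP.
- by apply/or3P; constructor 3; rewrite nb2.
Qed.

Lemma summarize1 v s : (summarize v s).1 = (last (None, v) s).2.
Proof. by elim/last_ind: s => //= s y _;
  rewrite /summarize -cats1 foldl_cat last_cat. Qed.

(** Continuations after a jump. Since [F] may land anywhere, positions are forgotten and only the
    existence of a suitable factor matters. *)
Inductive chain psi : Q -> Prop :=
| chain_end q q' : val q' = 1 -> (false, true, q, q') \in psi.2 -> chain psi q
| chain_jump q q1 q2 :
    (false, false, q, q1) \in psi.2 -> jump q1 q2 -> chain psi q2 -> chain psi q.

Definition start : Q := to_state (mem_states e).

Definition accepting psi : bool :=
  `[< (exists2 q, val q = 1 & (true, true, start, q) \in psi.2) \/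
      exists q1 q2, [/\ (true, false, start, q1) \in psi.2, jump q1 q2 &
                        chain psi q2] >].

Definition tail om i (b : bool) q q' := exists y q1 s1 s2,
  [/\ drop i om = y :: s1 ++ s2, b -> s2 = [::],
      tmove y.2 (val q) (val q1) & run move q1 s1 q'].

Lemma tail_segment om i b q q' : tail om i b q q' -> segment om false b q q'.
Proof.
move=> [y [q1 [s1 [s2 [om_i bs2 qq1 q1q']]]]].
by exists (take i om), y, q1, s1, s2; rewrite -om_i cat_take_drop.
Qed.

Lemma tail0_segment om b q q' : tail om 0 b q q' -> segment om true b q q'.
Proof.
move=> [y [q1 [s1 [s2 [om_i bs2 qq1 q1q']]]]].
by exists [::], y, q1, s1, s2; rewrite -om_i drop0.
Qed.

(** Only the local run in progress remembers its position [i]; once a jump occurs, [chain] suffices.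
    This is the invariant of the backward reading of an accepting run. *)
Definition good om psi i q :=
  (exists2 q', val q' = 1 & tail om i true q q') \/
  exists q1 q2, [/\ tail om i false q q1, jump q1 q2 & chain psi q2].

Lemma good_step om psi i j q r :
  (forall b q', tail om i b q q' -> tail om j b r q') ->
  good om psi i q -> good om psi j r.
Proof.
move=> tl [[q' q'1 /tl qq']|[q1 [q2 [/tl qq1 q12 q2f]]]].
  by left; exists q'.
by right; exists q1, q2.
Qed.

Lemma drop_nonempty om i : (i < size om)%N ->
  drop i om = nth (node0 Sigma Omega) om i :: drop i.+1 om.
Proof. exact: drop_nth. Qed.

Lemma word_rel_good v s (om := (None, v) :: s) w q i :
  srun (val q) w 1 -> word_rel om w i (size s) -> (i < size om)%N ->
  good om (summarize v s) i q.
Proof.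
have segP b1 b2 p p' : segment om b1 b2 p p' ->
  (b1, b2, p, p') \in (summarize v s).2.
  by move/mem_summarize.
move Er: (val q) => r; move Ef: 1 => f rf.
elim: rf q i Er Ef => {r w f} [r|r c r1 w f cr _ IH] q i Er Ef.
  rewrite /= => -> lti; left; exists q; rewrite ?Er //.
  exists (nth (node0 Sigma Omega) om (size s)), q, [::], [::]; split=> //=.
  - by rewrite drop_nonempty // drop_oversize.
  - exact: tmove_refl.
subst r; have [q1 Eq1] := sstep_state cr; subst r1.
case: c cr => [x|] cr /= ; last first.
  move=> wi lti; have := IH q1 i erefl Ef wi lti; apply: good_step => b q'.
  move=> [y [q2 [s1 [s2 [om_i bs2 qq1 q1q']]]]].
  by exists y, q2, s1, s2; split=> //; exact: tmove_eps qq1.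
move=> [j ij wj] lti; have ltj := letter_rel_gt ij.
have {IH} := IH q1 j erefl Ef wj ltj.
case: x cr ij => [a|p|] cr ij.
- apply: good_step => b q' [y [q2 [s1 [s2 [om_j bs2 qq1 q1q']]]]].
  move: ij => /and3P[/eqP Ej _ /eqP yj].
  have Ey : nth (node0 Sigma Omega) om j = y.
    by rewrite -[j]addn0 -nth_drop om_j.
  exists (nth (node0 Sigma Omega) om i), q, (y :: s1), s2; split=> //=.
  + by rewrite drop_nonempty // -Ej om_j.
  + exact: tmove_refl.
  + apply/existsP; exists q2; rewrite q1q' andbT /move -Ey yj.
    by apply/asboolP; exists (val q1); rewrite ?Ey.
- apply: good_step => b q' [y [q2 [s1 [s2 [om_j bs2 qq1 q1q']]]]].
  move: ij => /and3P[/eqP Ej _ vp]; subst j.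
  have Ey : nth (node0 Sigma Omega) om i = y.
    by rewrite -[i]addn0 -nth_drop om_j.
  by exists y, q2, s1, s2; split=> //; apply: (tmove_test cr) qq1; rewrite -Ey.
(* At [F] the current local run is empty, and the run that follows is weakened from a fixed start to
   an arbitrary factor. *)
- move=> gj; right; exists q, q1; split=> //.
    exists (nth (node0 Sigma Omega) om i), q, [::], (drop i.+1 om); split=> //=.
    + exact: drop_nonempty.
    + exact: tmove_refl.
  case: gj => [[q' q'1 /tail_segment/segP q1q']|[r1 [r2 [/tail_segment/segP q1r1
    r12 r2f]]]].
    exact: chain_end q1q'.
  exact: chain_jump r12 r2f.
Qed.

Lemma accepts_accepting v s :
  accepts e ((None, v) :: s) -> accepting (summarize v s).
Proof.
move=> [w /lang_srun ew w0]; apply/asboolP.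
have := @word_rel_good v s w start 0 ew w0 (ltn0Sn _).
case=> [[q q1 /tail0_segment/mem_summarize sq]|[q1 [q2
  [/tail0_segment/mem_summarize sq q12 q2f]]]].
  by left; exists q.
by right; exists q1, q2.
Qed.

End Local.

(** * Guarded words *)

Lemma run_foldl (T C : finType) (d : T -> C -> T) p w q :
  run (fun p c q => d p c == q) p w q = (foldl d p w == q).
Proof.
elim: w p => //= c w IH p; apply/existsP/idP => [[r /andP[/eqP<-]]|pq].
  by rewrite IH.
by exists (d p c); rewrite eqxx IH.
Qed.

Definition word_regex (X : Type) (w : seq X) : regex X :=
  foldr (fun a => Dot (Letter a)) 1 w.

Lemma lang_word_regex (X : Type) (w w' : seq X) :
  lang (word_regex w) w' <-> w' = w.
Proof.
elim: w w' => //= a w IH w'.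
split=> [[_ -> [v /IH-> <-]] //|->].
by exists [:: a] => //; exists w => //; apply/IH.
Qed.

(** The bridge used from here on: an inclusion of languages over a finite alphabet becomes a
    derivable inequation after substitution, whatever the hypotheses. *)
Lemma kle_ksubst_lang (X : Type) (C : finType) (H : hyps X) (s : C -> regex X)
  (e f : regex C) : lang e `<=` lang f -> kle H (ksubst s e) (ksubst s f).
Proof. by move/KA_complete; exact: kle_ksubst. Qed.

Definition anyword (C : finType) : regex C := Star (ksum (enum C) (@Letter C)).

Lemma lang_anyword (C : finType) (w : seq C) : lang (anyword C) w.
Proof.
elim: w => [|c w IH]; first exact: lang_star_nil.
apply: (@lang_star_cons _ _ [:: c]) IH; apply/(lang_ksum (enum C) (@Letter C)).
by exists c => //; rewrite mem_enum.
Qed.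

(** * Derivations from accepting summaries *)

Section Accepting.
Context (Sigma Omega : finType) (e : regex (katf_letter Sigma Omega)).
Local Notation At := {ffun Omega -> bool}.
Local Notation X := (katf_letter Sigma Omega).
Local Notation H := (@H_katf Sigma Omega).
Local Notation tst p := (Letter (@Test Sigma Omega p)).
Local Notation F := (Letter (@Full Sigma Omega)).
Local Notation "x <== y" := (kle H x y) (at level 70).
Local Notation node := (node Sigma Omega).
Local Notation Q := (state e).
Local Notation summary := (summary e).
Implicit Types (q : Q) (psi : summary) (v : At) (y : node) (s : seq node).

(** A position without incoming action is entered from its predecessor through [F]. *)
Definition action (c : option Sigma) : X := if c is Some a then Act a else Full.

Definition node_regex y : regex X := Letter (action y.1) * tst (atom y.2).

Local Notation sub := (ksubst node_regex).

Definition summary_mat := kmat (fun psi y psi' => advance psi y == psi').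

(** Guarded words with summary [psi]. *)
Definition summary_regex psi : regex X :=
  ksum (enum {: At}) (fun v => tst (atom v) * sub (summary_mat
    (summary0 e v) psi)).

Lemma lang_summary_mat v s psi :
  lang (summary_mat (summary0 e v) psi) s <-> summarize e v s = psi.
Proof.
split=> [/lang_kmat|sp]; first by rewrite run_foldl => /eqP.
by apply: run_kmat; rewrite run_foldl; apply/eqP.
Qed.

Lemma tmove_sound v (q q' : regex X) : tmove v q q' -> tst (atom v) * q' <== q.
Proof.
elim=> {q q'} [q|q q1 q' /(sstep_sound H) qq1 _ IH|q p q1 q' /(sstep_sound H)
  qq1 vp _ IH].
- rewrite -[X in _ <== X](KA_dot1x H); apply: kle_dot => //; exact: tst_le1.
- exact: kle_trans IH qq1.
(* The atom is duplicated: one copy pays for the test, the other for the rest of the moves. *)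
- apply: kle_trans qq1; have := atom_orth Sigma v v; rewrite eqxx => <-.
  rewrite -KA_dotA; apply: kle_dot IH; exact: atom_le.
Qed.

Lemma move_sound q y q' : move q y q' -> node_regex y * val q' <== val q.
Proof.
rewrite /move /node_regex; case: y =>
  -[a|] v //= /asboolP[q1 /(sstep_sound H) qq1 /tmove_sound].
by rewrite -KA_dotA => q1q'; apply: kle_trans qq1; exact: kle_dot.
Qed.

Lemma move_mat_sound q q' : sub (kmat (@move _ _ e) q q') * val q' <== val q.
Proof. by apply: kmat_left => p c p'; exact: move_sound. Qed.

Definition skip (b : bool) : regex X := if b then 1 else F.
Definition skipw (b : bool) : regex node := if b then 1 else anyword node.

(** The valuation [v] of the first position is not a letter of the word, so a factor starting there
    is described separately from one starting at a later node [y]. *)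
Definition segment_regex v b1 b2 q q' : regex node :=
  let from v := ksum [seq q1 <- enum {: Q} | `[< tmove v (val q) (val q1) >]]
    (fun q1 => kmat (@move _ _ e) q1 q' * skipw b2) in
  from v + (if b1 then 0 else
    anyword node * ksum (enum {: node}) (fun y => Letter y * from y.2)).

Lemma lang_segment_regex psi v b1 b2 q q' : (b1, b2, q, q') \in psi.2 ->
  lang (summary_mat (summary0 e v) psi) `<=` lang (segment_regex v b1 b2 q q').
Proof.
move=> qq' s /lang_summary_mat sp; move: qq';
  rewrite -sp => /mem_summarize[s0 [y [q1 [s1 [s2 [om b1s0 b2s2 qq1 q1q']]]]]].
have skip2 : lang (skipw b2) s2.
  by rewrite /skipw; case: b2 b2s2 => [->|_] //; exact: lang_anyword.
have from : lang (ksum [seq q1 <- enum {: Q} | `[< tmove y.2 (val q) (val q1) >]]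
    (fun q1 => kmat (@move _ _ e) q1 q' * skipw b2)) (s1 ++ s2).
  apply/lang_ksum; exists q1; first by rewrite mem_filter mem_enum andbT;
    apply/asboolP.
  by exists s1; [exact: run_kmat|exists s2].
case: s0 om b1s0 => [[yE ->] _|y0 s0 [_ ->]].
  by left; move: from; rewrite -yE.
case: b1 => [/(_ isT)//|_]; right; exists s0; first exact: lang_anyword.
exists (y :: s1 ++ s2) => //; apply/lang_ksum; exists y;
  first by rewrite mem_enum.
by exists [:: y] => //; exists (s1 ++ s2).
Qed.

Lemma skipw_skip b : sub (skipw b) * skip b <== skip b.
Proof. by case: b => /=; [rewrite KA_dotx1|exact: kleF]. Qed.

Lemma sub_from v b2 q q' z : skip b2 * z <== val q' ->
  tst (atom v) * (sub (ksum [seq q1 <- enum {: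
    Q} | `[< tmove v (val q) (val q1) >]]
    (fun q1 => kmat (@move _ _ e) q1 q' * skipw b2)) * (skip b2 * z)) <== val q.
Proof.
move=> zq'; rewrite ksubst_ksum ksum_dotl ksum_dotr; apply: ksum_lub => q1.
rewrite mem_filter => /andP[/asboolP/tmove_sound qq1 _].
apply: kle_trans qq1; apply: kle_dot => //=.
apply: kle_trans (move_mat_sound q1 q').
rewrite -KA_dotA; apply: kle_dot => //; apply: kle_trans zq'.
by rewrite KA_dotA; apply: kle_dot => //; exact: skipw_skip.
Qed.

(** By completeness the guarded words with summary [psi] lie below the expression of words
    containing the factor. Its surroundings are swallowed by [skip b1] and [skip b2], the factor
    leads from [q] to [q'], and [z] is what remains to be done. *)
Lemma segment_sound psi b1 b2 q q' z : (b1, b2, q, q') \in psi.2 ->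
  skip b2 * z <== val q' ->
  skip b1 * (summary_regex psi * (skip b2 * z)) <== skip b1 * val q.
Proof.
move=> qq' zq'; rewrite ksum_dotl ksum_dotr; apply: ksum_lub => v _.
have le_seg := kle_ksubst_lang H node_regex
  (@lang_segment_regex psi v b1 b2 q q' qq').
apply: kle_trans (kle_dot (kle_refl _ _)
  (kle_dot (kle_dot (kle_refl _ _) le_seg) (kle_refl _ _))) _.
rewrite /= -KA_dotA KA_dotDl !KA_dotDr; apply: kle_lub.
  by apply: kle_dot => //; exact: sub_from.
case: b1 {qq' le_seg} => /=; first by rewrite KA_dot0x !KA_dotx0; exact: kle0x.
rewrite !ksubst_ksum ksum_dotr ksum_dotl !ksum_dotr; apply: ksum_lub => y _ /=.
(* The regrouping gathers the leading [F], the first atom, the skipped nodes and the action of [y]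
   into a block below [F]; the atom of [y] is left to start the run. *)
have assoc x1 x2 x3 x4 x5 x6 x7 :
  KA H (x1 * (x2 * ((x3 * ((x4 * x5) * x6)) * x7)))
  ((x1 * (x2 * (x3 * x4))) * (x5 * (x6 * x7))) by rewrite !KA_dotA.
by rewrite /node_regex assoc; apply: kle_dot (kleF _) _; exact: sub_from.
Qed.

Lemma kle_iterF x n : x <== x * iter n (fun z => F * (x * z)) 1.
Proof.
elim: n => [|n IH] /=; first by rewrite KA_dotx1.
by apply: kle_trans (kle_mulF x) _; rewrite -KA_dotA; do 2!apply: kle_dot => //.
Qed.

(** The number [n] counts the local runs of the chain, each of which consumes one copy of
    [summary_regex psi]. *)
Lemma chain_sound psi q : chain psi q ->
  exists n, iter n (fun z => F * (summary_regex psi * z)) 1 <== F * val q.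
Proof.
elim=> {q} [q q' q'1 qq'|q q1 q2 qq1 /(sstep_sound H) q12 _ [n IH]].
  exists 1%N => /=; have := @segment_sound _ _ _ _ _ 1 qq'.
  by rewrite /= q'1 KA_dotx1; apply.
exists n.+1; apply: kle_trans _ (segment_sound qq1 q12).
by do 2!apply: kle_dot => //.
Qed.

(** Let [G] be [summary_regex psi]. In [G <= G F G F ... F G], the successive
    factors [G] provide the successive runs between jumps: what precedes and what
    follows such a run in [G] is absorbed by [F]. *)
Lemma accepting_sound psi : accepting psi -> summary_regex psi <== e.
Proof.
move=> /asboolP[[q q1 sq]|[q1 [q2 [sq /(sstep_sound H) q12 /chain_sound[n IH]]]]].
  have := @segment_sound _ _ _ _ _ 1 sq.
  by rewrite /= q1 !KA_dotx1 !KA_dot1x; apply.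
apply: kle_trans (kle_iterF _ n) _.
apply: kle_trans (kle_dot (kle_refl _ _) IH) _.
by have := segment_sound sq q12; rewrite !KA_dot1x.
Qed.

Lemma regex_rel_nodes om0 y s : regex_rel (om0 ++ y :: s)
  (sub (word_regex s)) (size om0) (size om0 + size s).
Proof.
elim: s om0 y => [|[c v] s IH] om0 y /=; first by apply/regex_rel1; rewrite addn0.
set om := om0 ++ _.
have nth_om : nth (node0 Sigma Omega) om (size om0).+1 = (c, v).
  by rewrite /om -cat_rcons nth_cat size_rcons ltnn subnn.
have lt_om : ((size om0).+1 < size om)%N.
  by rewrite size_cat /= !addnS !ltnS leq_addr.
apply/regex_rel_dot; exists (size om0).+1; last first.
  have := IH (rcons om0 y) (c, v).
  by rewrite size_rcons cat_rcons addSnnS.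
apply/regex_rel_dot; exists (size om0).+1; apply/regex_rel_letter.
  case: c {IH} om nth_om lt_om => [a|] om nth_om lt_om /=.
    by rewrite eqxx lt_om nth_om eqxx.
  by rewrite lt_om (ltnW lt_om).
by rewrite /= eqxx lt_om nth_om /= beval_atom eqxx.
Qed.

(** The converse direction is obtained algebraically: the expression of this single guarded word is
    derivably below [e], derivations are sound in models, and the word holds in its own model. *)
Lemma acceptsE v s : accepts e ((None, v) :: s) <-> accepting (summarize e v s).
Proof.
split=> [/accepts_accepting //|/accepting_sound acc].
pose x : regex X := tst (atom v) * sub (word_regex s).
have /kle_model xe : x <== e.
  have inv : v \in enum {: At} by rewrite mem_enum.
  apply: kle_trans acc; set psi := summarize e v s.
  apply: kle_trans _ (kle_ksum H (fun v => tst (atom v) *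
    sub (summary_mat (summary0 e v) psi)) inv).
  apply: kle_dot => //; apply: kle_ksubst_lang => w /lang_word_regex->.
  exact/lang_summary_mat.
have [w xw w0] : regex_rel ((None, v) :: s) x 0 (size s).
  apply/regex_rel_dot; exists 0%N; last exact: (regex_rel_nodes [::]).
  by apply/regex_rel_letter; rewrite /= beval_atom eqxx.
exact: xe xw v s w0.
Qed.

End Accepting.

(** * Reduction and completeness *)

Lemma lang_map_regex (C X : Type) (h : C -> X) (e : regex C) w :
  lang e w -> lang (map_regex h e) (map h w).
Proof.
elim: e w => [||a|e IHe f IHf|e IHe f IHf|e IHe] w //=.
- by move=> ->.
- by move=> ->.
- by move=> [/IHe|/IHf]; [left|right].
- move=> [u /IHe eu [v /IHf fv <-]]; rewrite map_cat.
  by exists (map h u) => //; exists (map h v).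
- elim/lang_star_ind: w / => [|u v /IHe eu _ IH]; first exact: lang_star_nil.
  by rewrite map_cat; exact: lang_star_cons.
Qed.

Lemma KA_ksubst2 (C X : Type) (H : hyps X) (s t : C -> regex X) (e : regex C) :
  (forall c, KA H (s c) (t c)) -> KA H (ksubst s e) (ksubst t e).
Proof.
by move=> st; elim: e => //= [e IHe f IHf|e IHe f IHf|e IHe];
  [exact: KA_plus|exact: KA_dot|exact: KA_star].
Qed.

Lemma ksubst_ksubst (B C X : Type) (s : C -> regex X) (t : B ->
  regex C) (e : regex B) :
  ksubst s (ksubst t e) = ksubst (fun b => ksubst s (t b)) e.
Proof. by elim: e => //= [e -> f ->|e -> f ->|e ->]. Qed.

Section Reduction.
Context (Sigma Omega : finType).
Local Notation At := {ffun Omega -> bool}.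
Local Notation X := (katf_letter Sigma Omega).
Local Notation H := (@H_katf Sigma Omega).
Local Notation tst p := (Letter (@Test Sigma Omega p)).
Local Notation F := (Letter (@Full Sigma Omega)).
Local Notation "x <== y" := (kle H x y) (at level 70).
Local Notation node := (node Sigma Omega).
Implicit Types (v : At) (y : node) (s : seq node).

(** [inl None] stands for [F]. *)
Definition alphabet := (option Sigma + At)%type.
HB.instance Definition _ := Finite.on alphabet.

Definition inj (x : alphabet) : X :=
  match x with inl c => action Omega c | inr v => Test (atom v) end.

Definition atomise (x : X) : regex alphabet :=
  match x with
  | Act a => Letter (inl (Some a))
  | Test p => ksum [seq v : At <- enum {: At} | beval v p] (fun v =>
    Letter (inr v))
  | Full => Letter (inl None)
  end.

Lemma KA_atomise (e : regex X) : KA H e (map_regex inj (ksubst atomise e)).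
Proof.
rewrite map_regexE ksubst_ksubst -[X in KA H X _]ksubst_Letter.
apply: KA_ksubst2 => -[a|p|] //=; rewrite ksubst_ksum /=.
apply: kle_anti; first exact: tst_split.
by apply: ksum_lub => v; rewrite mem_filter => /andP[vp _]; exact: atom_le.
Qed.

(** * Normal forms over atoms *)

Section Normal.
Context (e : regex X).
Local Notation summary := (summary e).
Implicit Types (psi : summary) (t : {set summary}).

(** A word over [alphabet], in which atoms need not alternate with actions, is
    represented by the summaries of all the guarded words that refine it. *)
Definition refine t (x : alphabet) : {set summary} :=
  match x with
  | inl c => [set advance p.1 (c, p.2) | p in finset.setX t [set: At]]
  | inr v => [set psi in t | psi.1 == v]
  end%SET.

Definition refine0 : {set summary} := [set summary0 e v | v : At].

Definition refine_mat := kmat (fun t x t' => refine t x == t').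

(** The empty set [t] is included: it is reached by words with two distinct atoms at one position,
    which equal [0] modulo the hypotheses. *)
Definition normal : regex alphabet :=
  ksum [seq t : {set summary} <- enum {set summary} | [forall psi in t,
    accepting psi]]
    (refine_mat refine0).

Local Notation S psi := (summary_regex psi).
Local Notation T t := (ksum (enum t) (@summary_regex _ _ e)).

Lemma summary_regex_node psi y :
  S psi * node_regex y <== S (advance psi y).
Proof.
rewrite ksum_dotl; apply: ksum_lub => v _.
have inv : v \in enum {: At} by rewrite mem_enum.
apply: kle_trans _ (kle_ksum H (fun v => tst (atom v) *
  ksubst (@node_regex _ _) (summary_mat (summary0 e v) (advance psi y))) inv).
rewrite -KA_dotA; apply: kle_dot => //.
apply: kle_trans _ (kmat_trans _ _ _ _ _ psi); apply: kle_dot => //.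
by apply: (kmat_step _ (@node_regex _ _) (c := y)).
Qed.

(** Every guarded word ends with the atom recorded in its summary, and tests are idempotent. *)
Lemma summary_regex_last psi : S psi <== S psi * tst (atom psi.1).
Proof.
apply: ksum_lub => v _.
have inv : v \in enum {: At} by rewrite mem_enum.
rewrite ksum_dotl; apply: kle_trans _ (kle_ksum H (fun v => tst (atom v) *
  ksubst (@node_regex _ _) (summary_mat (summary0 e v) psi) * tst
    (atom psi.1)) inv).
(* The family carries the final atom as an invariant along the automaton; each step drops the old
   final atom, being below [1], and duplicates that of the new node. *)
have := @kmat_right _ _ (fun psi y psi' => advance psi y == psi') _ H
  (@node_regex _ _) (fun psi => tst (atom v) *
  ksubst (@node_regex _ _) (summary_mat (summary0 e v) psi) * tst (atom psi.1)).
have vv : KA H (tst (atom v) * tst (atom v)) (tst (atom v)).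
  by rewrite atom_orth eqxx.
move=> /(_ _ (summary0 e v) psi) right; apply: kle_trans (right _).
  apply: kle_dot => //=; rewrite -{1}vv; apply: kle_dot => //.
  rewrite -{1}(KA_dotx1 H (tst _)); apply: kle_dot => //; exact: kmat_refl.
move=> p y _ /eqP<- /=; rewrite /node_regex.
set a := Letter _; set K := ksubst _ _; set c := Letter (action _ _).
set b := Letter (Test (atom y.2)).
have bb : KA H (b * b) b by rewrite /b atom_orth eqxx.
have p1 : tst (atom p.1) <== 1 by exact: tst_le1.
apply: (@kle_trans _ _ (a * K * 1 * (c * (b * b)))).
  by rewrite bb; do 2!apply: kle_dot => //.
rewrite KA_dotx1 !KA_dotA; apply: kle_dot => //.
rewrite -!KA_dotA; apply: kle_dot => //.
apply: kle_trans _ (kmat_trans _ _ _ _ _ p); apply: kle_dot => //.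
by apply: (kmat_step _ (@node_regex _ _) (c := y)).
Qed.

(** After an action, [1] is split into all atoms for the new position. An atom is absorbed by the
    summaries ending with it and annihilates the others. *)
Lemma refine_sound t x : T t * Letter (inj x) <== T (refine t x).
Proof.
rewrite ksum_dotl; apply: ksum_lub => psi; rewrite mem_enum => psit.
case: x => [c|v] /=.
  rewrite -(KA_dotx1 H (S psi * _)).
  apply: kle_trans (kle_dot (kle_refl _ _) (@tst_total Sigma Omega)) _.
  rewrite ksum_dotr; apply: ksum_lub => v _; rewrite -KA_dotA.
  apply: kle_trans (summary_regex_node psi (c, v)) _.
  apply: kle_ksum; rewrite mem_enum; apply/imsetP.
  by exists (psi, v) => //; rewrite !inE psit.
case: (eqVneq psi.1 v) => [pv|pv].
  apply: kle_trans (kle_dot (kle_refl _ _) (tst_le1 _ _)) _.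
  by rewrite KA_dotx1; apply: kle_ksum; rewrite mem_enum !inE psit pv eqxx.
apply: kle_trans (kle_dot (summary_regex_last psi) (kle_refl _ _)) _.
by rewrite -KA_dotA atom_orth (negbTE pv) KA_dotx0; exact: kle0x.
Qed.

Lemma normal_sound : map_regex inj normal <== e.
Proof.
rewrite map_regexE ksubst_ksum; apply: ksum_lub => t.
rewrite mem_filter => /andP[/forall_inP acc _].
apply: (@kle_trans _ _ (T t)); last first.
  by apply: ksum_lub => psi; rewrite mem_enum => /acc; exact: accepting_sound.
have := @kmat_right _ _ (fun t x t' => refine t x == t') _ H
  (fun x => Letter (inj x)) (fun t => T t) _ refine0 t.
move=> right; apply: kle_trans (right _); last first.
  by move=> p x _ /eqP<-; exact: refine_sound.
rewrite -{1}(KA_dot1x H (ksubst _ _)); apply: kle_dot => //.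
apply: kle_trans (@tst_total Sigma Omega) _; apply: ksum_lub => v _.
have inv : summary0 e v \in enum refine0 by rewrite mem_enum imset_f.
apply: kle_trans _ (kle_ksum H _ inv).
have {}inv : v \in enum {: At} by rewrite mem_enum.
apply: kle_trans _ (kle_ksum H (fun v' => tst (atom v') *
  ksubst (@node_regex _ _) (summary_mat (summary0 e v') (summary0 e v))) inv).
rewrite -{1}(KA_dotx1 H (tst _)); apply: kle_dot => //; exact: kmat_refl.
Qed.

(** The model is built along [w]: an action or [F] appends a position with the chosen valuation,
    while an atom only constrains the last one. *)
Lemma refineP (w : seq alphabet) psi : psi \in foldl refine refine0 w ->
  exists v s, psi = summarize e v s /\
    word_rel ((None, v) :: s) (map inj w) 0 (size s).
Proof.
elim/last_ind: w psi => [|w x IH] psi.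
  by move=> /imsetP[v _ ->]; exists v, [::].
rewrite -cats1 foldl_cat map_cat /=; case: x => [c|v'] /=.
  move=> /imsetP[[p v'] /finset.setXP[/IH[v [s [-> vs]]] _] ->] /=.
  exists v, (rcons s (c, v')); split.
    by rewrite /summarize -cats1 foldl_cat.
  rewrite -rcons_cons; apply/word_rel_cat; exists (size s).
    exact: word_rel_rcons.
  rewrite size_rcons /=; exists (size s).+1 => //.
  case: c => [a|] /=; rewrite !size_rcons !ltnS leqnn ?leqnSn //.
  by rewrite nth_rcons ltnn eqxx /= !eqxx.
rewrite inE => /andP[/IH[v [s [-> vs]]] /eqP pv].
exists v, s; split=> //; apply/word_rel_cat; exists (size s) => //=.
exists (size s) => //; rewrite eqxx ltnSn /= -pv summarize1.
by rewrite (last_nth (node0 Sigma Omega)) beval_atom.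
Qed.

Lemma normal_complete (w : seq alphabet) :
  model_lang e (map inj w) -> lang normal w.
Proof.
move=> ew; apply/lang_ksum; exists (foldl refine refine0 w).
  rewrite mem_filter mem_enum andbT; apply/forall_inP => psi.
  by move=> /refineP[v [s [-> vs]]]; apply/acceptsE; exact: ew.
by apply: run_kmat; rewrite run_foldl.
Qed.

(** For the upper bound, tests are first replaced by sums of atoms; each word of the result lies in
    [model_lang e] by soundness, hence in the normal form, and completeness turns the inclusion into
    a derivation. *)
Lemma KA_normal : KA H e (map_regex inj normal).
Proof.
apply: kle_anti; last exact: normal_sound.
apply: kle_trans (KA_kle (KA_atomise e)) _; rewrite !map_regexE.
apply: kle_ksubst_lang => w ew; apply: normal_complete.
have /kle_model : map_regex inj (ksubst atomise e) <== e.
  exact: KA_kle (KA_sym (KA_atomise e)).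
by apply; exact: lang_map_regex.
Qed.

End Normal.

Lemma closure_model (e : regex X) : hyp_closure H (lang e) `<=` model_lang e.
Proof.
move=> w; apply; split; [exact: model_lang_closed|exact: lang_model].
Qed.

Lemma closure_normal (e : regex X) (w : seq alphabet) :
  hyp_closure H (lang e) (map inj w) -> lang (normal e) w.
Proof. by move/closure_model/normal_complete. Qed.

Theorem H_katf_reduces : reduces_to_empty H.
Proof.
exists (range inj); split=> //.
pose h x : range inj := SigSub (mem_set (imageT inj x)).
exists (fun e => map_regex h (normal e)) => e; split.
  have -> : embed (map_regex h (normal e)) = map_regex inj (normal e).
    by rewrite /embed; elim: (normal e) => //= [e1 -> e2 ->|e1 -> e2 ->|e1 ->].
  exact: KA_normal.
move=> w ew M [_]; apply.
(* Letters of the range of [inj] are lifted to [alphabet], where [closure_normal] applies. *)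
have [w' wE] : exists w', w = map h w'.
  elim: w {ew} => [|x w [w' ->]]; first by exists [::].
  have [y _ yx] := set_mem (valP x).
  by exists (y :: w'); congr cons; apply: val_inj.
subst w; have injE u : map inj u = map (fun x : range inj => sval x) (map h u).
  by elim: u => //= x u ->.
by apply: lang_map_regex; apply: closure_normal; rewrite injE.
Qed.

Theorem H_katf_complete : complete H.
Proof.
have sub (e f : regex X) : hyp_closure H (lang e) = hyp_closure H (lang f) ->
  e <== f.
  move=> ef; apply: kle_trans (KA_kle (KA_normal e)) _.
  apply: kle_trans (KA_kle (KA_sym (KA_normal f))).
  rewrite !map_regexE; apply: kle_ksubst_lang => w /(lang_map_regex inj) ew.
  apply: closure_normal; rewrite -ef; apply: kle_closure ew.
  exact: KA_kle (KA_sym (KA_normal e)).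
by move=> e f ef; apply: kle_anti; exact: sub.
Qed.

(** Completeness for relational models, the form of the result on which the decision procedure
    relies. *)
Theorem KA_accepts (e f : regex X) : KA H e f <->
  forall v s, accepts e ((None, v) :: s) <-> accepts f ((None, v) :: s).
Proof.
have acc (e1 f1 : regex X) : KA H e1 f1 -> forall v s,
    accepts e1 ((None, v) :: s) -> accepts f1 ((None, v) :: s).
  move=> /KA_kle/kle_model ef v s [w ew w0].
  exact: ef ew v s w0.
split=> [ef v s|ef]; first by split; apply: acc => //; exact: KA_sym.
have sub (e1 f1 : regex X) : (forall v s,
    accepts e1 ((None, v) :: s) -> accepts f1 ((None, v) :: s)) -> e1 <== f1.
  move=> ef1; apply: kle_trans (KA_kle (KA_normal e1)) _.
  apply: kle_trans (KA_kle (KA_sym (KA_normal f1))).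
  rewrite !map_regexE; apply: kle_ksubst_lang => w /(lang_map_regex inj) ew.
  apply: normal_complete => v s vs; apply: ef1.
  have /kle_model e1w : map_regex inj (normal e1) <== e1.
    exact: KA_kle (KA_sym (KA_normal e1)).
  exact: e1w ew v s vs.
by apply: kle_anti; apply: sub => v s /ef.
Qed.

End Reduction.

(** * Decidability *)

Lemma short_foldl (T : finType) (C : Type) (d : T -> C -> T) t (s : seq C) :
  exists2 s' : seq C, (size s' < #|T|)%N & foldl d t s' = foldl d t s.
Proof.
have [n] := ubnP (size s); elim: n s => // n IH s /ltnSE le_sn.
case: (ltnP (size s) #|T|) => [lt_s|ge_s]; first by exists s.
(* There are [size s + 1] prefixes and at most [size s] states; the part between two prefixes
   reaching the same state is cut out. *)
pose at_ (i : 'I_(size s).+1) := foldl d t (take i s).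
have /injectivePn[i [j ij Eij]] : ~~ injectiveb at_.
  apply/negP => /injectiveP/leq_card; rewrite card_ord => le_sT.
  by have := leq_trans le_sT ge_s; rewrite ltnn.
wlog lt_ij : i j ij Eij / (i < j)%N => [wlg|].
  case: (ltngtP i j) => [lt_ij|lt_ji|/val_inj Eij2].
  - exact: wlg lt_ij.
  - by apply: (wlg j i); rewrite // eq_sym.
  - by rewrite Eij2 eqxx in ij.
have le_js : (j <= size s)%N by rewrite -ltnS.
have [|s' s'T Es'] := IH (take i s ++ drop j s).
  rewrite size_cat size_take_min size_drop (leq_trans _ le_sn) //.
  rewrite (minn_idPl (leq_trans (ltnW lt_ij) le_js)).
  by rewrite -[X in (_ < X)%N](subnKC le_js) ltn_add2r.
exists s' => //; rewrite Es' foldl_cat -/(at_ i) Eij /at_ -foldl_cat.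
by rewrite cat_take_drop.
Qed.

(** * A bound on the size of distinguishing models *)

Section Bound.
Context (Sigma Omega : finType).
Local Notation X := (katf_letter Sigma Omega).
Local Notation node := (node Sigma Omega).
Implicit Types (e f : regex X) (om : seq node).

Lemma letter_rel_label (c : option Sigma) v om x i j :
  letter_rel ((c, v) :: om) x i j = letter_rel ((None, v) :: om) x i j.
Proof.
case: x => [a|p|] //=; first by case: eqP => // ->.
by case: i.
Qed.

(** No action leads to position [0], so the first label is never read and models may be enumerated
    over all nodes. *)
Lemma accepts_label (c : option Sigma) v om e :
  accepts e ((c, v) :: om) <-> accepts e ((None, v) :: om).
Proof.
have wE w i j : word_rel ((c, v) :: om) w i j <-> word_rel ((None, v) ::
  om) w i j.
  elim: w i => //= x w IH i.
  by split=> -[k ik /IH kj]; exists k => //; move: ik; rewrite letter_rel_label.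
by split=> -[w ew /wE w0]; exists w.
Qed.

(** Bounds the number of pairs of summaries, hence the length of a shortest word
    accepted by only one of two expressions. *)
Definition pairs_bound (m : nat) : nat := (2 ^ (2 ^ (#|Omega| + 3 + (m + m))))%N.

Lemma card_summary e : #|{: summary e}| =
  (2 ^ (#|Omega| + 4 * #|{: state e}| ^ 2))%N.
Proof.
have card_setT (T : finType) : #|{: {set T}}| = (2 ^ #|T|)%N.
  by rewrite -(cardsT T) -card_powerset powersetT cardsT.
rewrite card_prod card_ffun card_bool card_setT !card_prod card_bool expnD.
by congr (_ * 2 ^ _)%N; rewrite -mulnA.
Qed.

Lemma card_summaries e f (m := (rsize e + rsize f)%N) :
  (#|{: summary e * summary f}| <= pairs_bound m)%N.
Proof.
rewrite card_prod !card_summary -expnD leq_exp2l //.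
have [le_e le_f] := (card_state e, card_state f).
set o := #|Omega|; set M := (2 ^ m)%N.
have lt_m : (m < M)%N by exact: ltn_expl.
have lt_o : (o < 2 ^ o)%N by exact: ltn_expl.
have -> : (2 ^ (o + 3 + (m + m)) = 8 * 2 ^ o * M ^ 2)%N.
  by rewrite !expnD (mulnC (2 ^ o)%N) mulnn -(expnD 2 (rsize e)).
have le_sq : (#|{: state e}| ^ 2 + #|{: state f}| ^ 2 <= M ^ 2)%N.
  apply: (@leq_trans ((rsize e) ^ 2 + (rsize f) ^ 2)%N).
    by apply: leq_add; rewrite leq_exp2r.
  apply: (@leq_trans (m ^ 2)%N); last by rewrite leq_exp2r // ltnW.
  by rewrite sqrnD leq_addr.
have M1 : (0 < M ^ 2)%N by rewrite !expn_gt0.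
have o1 : (0 < 2 ^ o)%N by rewrite expn_gt0.
(* The exponents to compare are [2o] plus four times the sum of squares, and [8 * 2 ^ o * M ^ 2];
   each intermediate summand is at most half of the latter. *)
apply: (@leq_trans (4 * M ^ 2 + 4 * 2 ^ o)%N).
  rewrite addnACA -mulnDr addnC; apply: leq_add;
    first by rewrite leq_mul2l le_sq orbT.
  by apply: leq_trans (_ : 2 * 2 ^ o <= _)%N;
    rewrite ?leq_mul2r ?orbT // mul2n -addnn leq_add // ltnW.
have -> : (8 * 2 ^ o * M ^ 2 = 4 * (2 ^ o * M ^ 2) + 4 * (2 ^ o * M ^ 2))%N.
  by rewrite -mulnDl mulnA.
by apply: leq_add; rewrite leq_mul2l /= ?leq_pmull ?leq_pmulr.
Qed.

Lemma KA_bounded e f (N := pairs_bound (rsize e + rsize f)) :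
  KA (@H_katf Sigma Omega) e f <->
  forall om : seq node, om <> [::] -> (size om <= N)%N ->
    accepts e om <-> accepts f om.
Proof.
rewrite KA_accepts; split=> [ef [//|[c v] s _ _]|ef v s].
  by rewrite !accepts_label.
pose d (t : summary e * summary f) y := (advance t.1 y, advance t.2 y).
have [s' le_s' Es'] := short_foldl d (summary0 e v, summary0 f v) s.
have dE (t : summary e * summary f) u :
    foldl d t u = (foldl (@advance _ _ e) t.1 u, foldl (@advance _ _ f) t.2 u).
  by elim: u t => [[]|y u IH] t //=; rewrite IH.
move: Es'; rewrite !dE /= => -[Ee Ef].
rewrite !acceptsE /summarize -Ee -Ef -!acceptsE; apply: ef => //=.
(* The strict bound on [s'] leaves room for the first position. *)
exact: leq_trans le_s' (card_summaries e f).
Qed.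

End Bound.

(** * Computing the relations on bit vectors *)

Section Image.
Context (Sigma Omega : finType).
Local Notation X := (katf_letter Sigma Omega).
Local Notation node := (node Sigma Omega).
Local Notation node0 := (node0 Sigma Omega).
Implicit Types (e f : regex X) (om : seq node) (S : bitseq).

Fixpoint por (S T : bitseq) : bitseq :=
  match S, T with b :: S', c :: T' => (b || c) :: por S' T' | _, _ => [::] end.

Fixpoint ptest (p : bexp Omega) S om : bitseq :=
  match S, om with
  | b :: S', y :: om' => (b && beval y.2 p) :: ptest p S' om'
  | _, _ => [::]
  end.

(** The bit [prev] of the preceding position implements the shift by one that an action performs. *)
Fixpoint pact (a : Sigma) (prev : bool) S om : bitseq :=
  match S, om with
  | b :: S', y :: om' => (prev && (y.1 == Some a)) :: pact a b S' om'
  | _, _ => [::]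
  end.

Fixpoint pstar (F : bitseq -> bitseq) (n : nat) S : bitseq :=
  if n is n.+1 then pstar F n (por S (F S)) else S.

(** Sets of positions are represented by bit vectors. *)
Fixpoint reach e om S : bitseq :=
  match e with
  | Zero => map (fun=> false) S
  | One => S
  | Letter (Act a) => pact a false S om
  | Letter (Test p) => ptest p S om
  | Letter Full => map (fun=> has id S) S
  | Plus e f => por (reach e om S) (reach f om S)
  | Dot e f => reach f om (reach e om S)
  | Star e => pstar (reach e om) (size om) S
  end.

Definition paccepts e om : bool :=
  last false (reach e om (true :: map (fun=> false) (behead om))).

Lemma size_por S T : size S = size T -> size (por S T) = size S.
Proof. by elim: S T => [|b S IH] [|c T] //= [/IH->]. Qed.

Lemma nth_por S T i : size S = size T ->
  nth false (por S T) i = nth false S i || nth false T i.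
Proof. by elim: S T i => [|b S IH] [|c T] // [|i] //= [/IH->]. Qed.

Lemma size_reach e om S : size S = size om -> size (reach e om S) = size om.
Proof.
elim: e S => [||[a|p|]|e IHe f IHf|e IHe f IHf|e IHe] S //= sS.
- by rewrite size_map.
- elim: S om false sS => [|b S IH] [|y om] c //= [sS]; by rewrite IH.
- elim: S om sS => [|b S IH] [|y om] //= [sS]; by rewrite IH.
- by rewrite size_map.
- by rewrite size_por ?IHe ?IHf.
- by rewrite IHf ?IHe.
- elim: (X in pstar _ X) S sS => //= m IH S sS.
  by rewrite IH ?size_por // IHe.
Qed.

Lemma nth_pact a c S om j : size S = size om ->
  nth false (pact a c S om) j =
  [&& nth false (c :: S) j, (j < size om)%N & (nth node0 om j).1 == Some a].
Proof.
elim: S om c j => [|b S IH] [|y om] c [|j] //=; try by rewrite ?nth_nil ?andbF.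
by case=> /IH->.
Qed.

Lemma nth_ptest p S om j : size S = size om ->
  nth false (ptest p S om) j = nth false S j && beval (nth node0 om j).2 p.
Proof.
elim: S om j => [|b S IH] [|y om] [|j] //=; try by rewrite ?nth_nil.
by case=> /IH->.
Qed.

Lemma connect_short (T : finType) (r : rel T) x y : connect r x y ->
  exists p, [/\ path r x p, y = last x p & (size p < #|T|)%N].
Proof.
move=> /connectP[p rp ->]; case: (shortenP rp) => p' rp' up' _.
exists p'; split=> //; have := card_uniqP up'; rewrite /= => <-.
exact: max_card.
Qed.

(** The bound on [j] excludes the positions outside the model that the empty word relates to
    themselves. For a star, [size om] rounds suffice because a simple path has fewer steps than
    there are positions. *)
Lemma reachP e om S j : size S = size om ->
  nth false (reach e om S) j <->
  exists2 i, nth false S i & regex_rel om e i j /\ (j < size om)%N.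
Proof.
move=> sS; have ltS (T : bitseq) i : size T = size om -> nth false T i ->
  (i < size om)%N.
  by move=> sT; case: ltnP => // le_i; rewrite nth_default ?sT.
elim: e S j sS => [||[a|p|]|e IHe f IHf|e IHe f IHf|e IHe] S j sS.
- split=> [|[i _ [/regex_rel0]]] //=.
  by rewrite (_ : map _ S = nseq (size S) false) ?nth_nseq ?if_same //;
    elim: (S) => //= ? ? ->.
- split=> [Sj|[i Si [/regex_rel1<-]]] //; exists j => //.
  by split; [exact/regex_rel1|exact: ltS Sj].
- rewrite /= nth_pact //; split.
    case: j => // j /and3P[Sj lt_j yj]; exists j => //.
    by split=> //; apply/regex_rel_letter; rewrite /= eqxx lt_j.
  by move=> [i Si [/regex_rel_letter/and3P[/eqP-> lt_i yi] lt_j]]; apply/and3P.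
- rewrite /= nth_ptest //; split.
    move=> /andP[Sj pj]; have lt_j := ltS _ _ sS Sj; exists j => //.
    by split=> //; apply/regex_rel_letter; rewrite /= eqxx lt_j.
  by move=> [i Si [/regex_rel_letter/and3P[/eqP-> _ pi] _]]; rewrite Si.
- rewrite /=; split.
    case: (ltnP j (size S)) => [lt_j|le_j]; last by rewrite nth_default ?size_map.
    rewrite (nth_map false) // => /(has_nthP false)[i lt_i Si]; exists i => //.
    rewrite sS in lt_i lt_j *; split=> //.
    by apply/regex_rel_letter; rewrite /= lt_i.
  move=> [i Si [_ lt_j]]; rewrite (nth_map false) ?sS //.
  by apply/(has_nthP false); exists i => //; rewrite sS; exact: ltS Si.
- rewrite /= nth_por ?size_reach //; split.
    move=> /orP[/(IHe _ _ sS)|/(IHf _ _ sS)] [i Si [ij lt_j]]; exists i => //;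
      split=> //;
      apply/regex_rel_plus; by [left|right].
  move=> [i Si [/regex_rel_plus[ij|ij] lt_j]]; apply/orP; [left;
    apply/IHe|right; apply/IHf] => //;
    by exists i.
- rewrite /=; split.
    move=> /(IHf _ _ (size_reach e sS))[k /(IHe _ _ sS)[i Si [ik _]] [kj lt_j]].
    by exists i => //; split=> //; apply/regex_rel_dot; exists k.
  move=> [i Si [/regex_rel_dot[k ik kj] lt_j]]; apply/IHf;
    first by rewrite size_reach.
  exists k => //; apply/IHe => //; exists i => //; split=> //.
  by have [w _ w_ik] := ik; apply: word_rel_gt w_ik; exact: ltS Si.
- have starS i k l : regex_rel om e i k -> regex_rel om (Star e) k l ->
  regex_rel om (Star e) i l.
    move=> ik kl; have [w ew il] : regex_rel om (e * Star e) i l.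
      by apply/regex_rel_dot; exists k.
    exists w => //; move: ew => [u eu [v ev <-]]; exact: lang_star_cons.
  rewrite /=; split.
    move: {1}(size om) => n; elim: n S sS => [|n IH] S sS /=.
      move=> Sj; exists j => //; split; last exact: ltS Sj.
      by exists [::] => //; exact: lang_star_nil.
    have sI : size (por S (reach e om S)) = size om by rewrite size_por
      ?size_reach.
    move=> /(IH _ sI)[i].
    rewrite nth_por ?size_reach // =>
      /orP[Si ij|/(IHe _ _ sS)[k Sk [ki _]] [ij lt_j]].
      by exists i.
    by exists k => //; split=> //; exact: starS ij.
  move=> [i Si [[w ew ij] lt_j]].
  have lt_i := ltS _ _ sS Si.
  pose r (k l : 'I_(size om)) := `[< regex_rel om e k l >].
  have {w ew ij} : connect r (Ordinal lt_i) (Ordinal lt_j).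
    elim/lang_star_ind: w / ew i lt_i ij {Si} => [|u v eu _ IH] i lt_i.
      by move=> /= ij; rewrite (_ : Ordinal lt_i = Ordinal lt_j) //;
        exact: val_inj.
    move=> /word_rel_cat[k ik kj]; have lt_k := word_rel_gt lt_i ik.
    apply: connect_trans (IH k lt_k kj); apply: connect1.
    by apply/asboolP; exists u.
  move=> /connect_short[p [rp]]; rewrite card_ord => /(congr1 val)/= -> {j lt_j}.
  have : nth false S (Ordinal lt_i) by [].
  move: (Ordinal lt_i) rp => k {i lt_i Si} rp Sk lt_p.
  (* A position once reached keeps its bit, so a path shorter than the number of rounds is also
     followed to its end. *)
  have mono n : forall S', size S' = size om -> nth false S' k ->
    forall p, path r k p ->
    (size p <= n)%N -> nth false (pstar (reach e om) n S') (last k p).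
    move=> {S sS rp Sk lt_p p}; elim: n k => [|n IH] k S sS Sk [|l p] //=.
      move=> _ _; apply: (IH k _ _ _ [::]) => //;
        first by rewrite size_por ?size_reach.
      by rewrite nth_por ?size_reach // Sk.
    move=> /andP[/asboolP kl rp]; rewrite ltnS => le_p; apply: IH => //.
      by rewrite size_por ?size_reach.
    rewrite nth_por ?size_reach //; apply/orP; right; apply/IHe => //.
    by exists (val k).
  exact: mono (ltnW lt_p).
Qed.

Lemma paccepts_accepts e om : om <> [::] -> paccepts e om <-> accepts e om.
Proof.
case: om => // y om _; rewrite /paccepts /accepts /=.
set S := true :: _; have sS : size S = size (y :: om) by rewrite /= size_map.
have nthS i : nth false S i = (i == 0%N).
  case: i => //= i; case: (ltnP i (size om)) => le_i.
    by rewrite (nth_map y).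
  by rewrite nth_default ?size_map.
rewrite -nth_last size_reach //=.
split=> [/(reachP _ _ sS)[i]|w0]; first by rewrite nthS => /eqP-> [].
by apply/reachP => //; exists 0%N; rewrite ?nthS.
Qed.

End Image.

(* Total correctness of programs *)
Local Close Scope regex_scope.

Definition calls (P : program) (k : nat) (y v :
  sexp) := eval P y (nth TNil P k) v.

(** A weakest precondition for terminating evaluation. Calls are discharged by facts about [calls],
    so recursion is handled by induction outside [wp]. *)
Fixpoint wp (P : program) (x : sexp) (t : term) (post : sexp -> Prop) : Prop :=
  match t with
  | TArg => post x
  | TNil => post SNil
  | TCons t1 t2 => wp P x t1 (fun a => wp P x t2 (fun b => post (SCons a b)))
  | TCar t => wp P x t (fun a => post (scar a))
  | TCdr t => wp P x t (fun a => post (scdr a))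
  | TIf c t1 t2 =>
      wp P x c (fun a => if a is SCons _ _ then wp P x t1 post else wp P x t2
        post)
  | TCall k t => wp P x t (fun y => exists2 v, calls P k y v & post v)
  end.

Lemma wp_eval P x t post : wp P x t post -> exists2 v, eval P x t v & post v.
Proof.
elim: t post => [||t1 IH1 t2 IH2|t IH|t IH|c IHc t1 IH1 t2 IH2|k t IH] post /=.
- by exists x => //; exact: eval_arg.
- by exists SNil => //; exact: eval_nil.
- move=> /IH1[a ea /IH2[b eb ab]]; exists (SCons a b) => //; exact: eval_cons.
- by move=> /IH[a ea pa]; exists (scar a) => //; exact: eval_car.
- by move=> /IH[a ea pa]; exists (scdr a) => //; exact: eval_cdr.
- move=> /IHc[[|a b] ec]; first by move=> /IH2[v ev pv]; exists v => //;
  exact: eval_if_false ev.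
  by move=> /IH1[v ev pv]; exists v => //; exact: eval_if_true ec ev.
- by move=> /IH[y ey [v yv pv]]; exists v => //; exact: eval_call ey yv.
Qed.

Lemma wp_calls P k y v : wp P y (nth TNil P k) (eq^~ v) -> calls P k y v.
Proof. by move=> /wp_eval[w ev <-]. Qed.

Definition sbool (b : bool) : sexp := if b then SCons SNil SNil else SNil.
Definition slist (l : seq sexp) : sexp := foldr SCons SNil l.
Definition sbits (S : bitseq) : sexp := slist (map sbool S).

Fixpoint quote (s : sexp) : term :=
  if s is SCons a b then TCons (quote a) (quote b) else TNil.

Lemma wp_quote P x s (post : sexp -> Prop) : post s -> wp P x (quote s) post.
Proof. by elim: s post => //= a IHa b IHb post pab; apply: IHa; exact: IHb. Qed.

Fixpoint sexp_eqb (s t : sexp) : bool :=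
  match s, t with
  | SNil, SNil => true
  | SCons a b, SCons c d => sexp_eqb a c && sexp_eqb b d
  | _, _ => false
  end.

Lemma sexp_eqP s t : reflect (s = t) (sexp_eqb s t).
Proof.
elim: s t => [|a IHa b IHb] [|c d] /=; try by constructor.
apply: (iffP andP) => [[ac bd]|[<- <-]]; last by split; [exact/IHa|exact/IHb].
by rewrite (elimT (IHa c) ac) (elimT (IHb d) bd).
Qed.

Fixpoint ssize (s : sexp) : nat :=
  if s is SCons a b then (ssize a + ssize b).+1 else 0.

(** Dispatch on a unary constructor number, one [TCdr] per skipped branch; the last branch is
    entered without a test. *)
Definition tcases (c : term) (l : seq term) : term :=
  (fix cases c l := match l with
    | [::] => TNil
    | [:: t] => t
    | t :: l => TIf c (cases (TCdr c) l) t
    end) c l.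

(** * The decision program *)

Section Program.
Context (Sigma Omega : finType).
Local Notation At := {ffun Omega -> bool}.
Local Notation X := (katf_letter Sigma Omega).
Local Notation node := (node Sigma Omega).
Implicit Types (e f : regex X) (om : seq node) (y : node).

(** The code of [None] has a nonempty head, unlike every unary number, so it differs from all codes
    of actions. *)
Definition slabel (c : option Sigma) : sexp :=
  if c is Some a then scode_fin a else SCons (SCons SNil SNil) SNil.
Definition svaluation (v : At) : sexp := sbits (map v (enum Omega)).
Definition snode_code y : sexp := SCons (slabel y.1) (svaluation y.2).
Definition sword om : sexp := slist (map snode_code om).
Local Notation code := (scode_regex (@scode_letter Sigma Omega)).

(** Functions with several parameters take right-nested pairs; [xi] is the [i]-th
    parameter, [ri] the pair of the following ones, and [field i] the [i]-th
    component of the coded node [x1]. *)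
Let ttrue := TCons TNil TNil.
Let x1 := TCar TArg.
Let r1 := TCdr TArg.
Let x2 := TCar r1.
Let r2 := TCdr r1.
Let x3 := TCar r2.
Let r3 := TCdr r2.
Let field (i : nat) := TCar (iter i TCdr (TCdr x1)).

(** The bound of [pairs_bound] is computed in unary with the size of the input in place of the sizes
    of the automata; the search starts from the empty word. *)
Definition prog_main : term :=
  TCall 13 (TCons (TCall 14 (TCall 14 (TCall 16 (TCons
    (quote (scode_nat (#|Omega| + 3)))
    (TCall 16 (TCons (TCall 17 TArg) (TCall 17 TArg)))))))
    (TCons TNil TArg)).

Definition prog_eq : term :=
  TIf x1
    (TIf r1
      (TIf (TCall 1 (TCons (TCar x1) (TCar r1)))
        (TCall 1 (TCons (TCdr x1) (TCdr r1))) TNil)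
      TNil)
    (TIf r1 TNil ttrue).

Definition prog_nth : term :=
  TIf x1 (TCall 2 (TCons (TCdr x1) (TCdr r1))) (TCar r1).

Definition prog_beval : term :=
  let rec i := TCall 3 (TCons (field i) r1) in
  tcases (TCar x1)
    [:: TCall 2 (TCons (field 0) r1);
        TIf (rec 0) ttrue (rec 1);
        TIf (rec 0) (rec 1) TNil;
        TIf (rec 0) TNil ttrue;
        TNil;
        ttrue].

Definition prog_test : term :=
  TIf x2
    (TCons (TIf (TCar x2) (TCall 3 (TCons x1 (TCdr (TCar r2)))) TNil)
           (TCall 4 (TCons x1 (TCons (TCdr x2) (TCdr r2)))))
    TNil.

Definition prog_act : term :=
  TIf x3
    (TCons (TIf x2 (TCall 1 (TCons (TCar (TCar r3)) x1)) TNil)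
           (TCall 5 (TCons x1 (TCons (TCar x3) (TCons (TCdr x3) (TCdr r3))))))
    TNil.

Definition prog_or : term :=
  TIf x1
    (TCons (TIf (TCar x1) ttrue (TCar r1)) (TCall 6 (TCons (TCdr x1) (TCdr r1))))
    TNil.

Definition prog_any : term := TIf TArg (TIf x1 ttrue (TCall 7 r1)) TNil.

Definition prog_fill : term :=
  TIf r1 (TCons x1 (TCall 8 (TCons x1 (TCdr r1)))) TNil.

Definition prog_reach : term :=
  let letter := field 0 in
  let arg := TCar (TCdr letter) in
  let rec i := TCall 9 (TCons (field i) r1) in
  tcases (TCar x1)
    [:: TCall 8 (TCons TNil x2);
        x2;
        tcases (TCar letter)
          [:: TCall 5 (TCons arg (TCons TNil r1));
              TCall 4 (TCons arg r1);
              TCall 8 (TCons (TCall 7 x2) x2)];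
        TCall 6 (TCons (rec 0) (rec 1));
        TCall 9 (TCons (field 1) (TCons (rec 0) r2));
        TCall 10 (TCons r2 (TCons (field 0) r1))].

(** The first parameter is a suffix of the word, serving as a unary counter for the rounds of
    [pstar]. *)
Definition prog_star : term :=
  TIf x1
    (TCall 10 (TCons (TCdr x1) (TCons x2
      (TCons (TCall 6 (TCons x3 (TCall 9 (TCons x2 (TCons x3 r3))))) r3))))
    x3.

Definition prog_last : term := TIf r1 (TCall 11 r1) x1.

Definition prog_accepts : term :=
  TCall 11 (TCall 9 (TCons x1
    (TCons (TCons ttrue (TCall 8 (TCons TNil (TCdr r1)))) r1))).

Definition prog_extend (y : node) : term :=
  TCall 13 (TCons (TCdr x1) (TCons (TCons (quote (snode_code y)) x2) r2)).

(** As [Sigma] and [Omega] are fixed, the loop over all nodes is unrolled into the text of the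
    program. *)
Definition prog_check : term :=
  TIf (TIf x2
        (TCall 1 (TCons (TCall 12 (TCons (TCar r2) x2))
                        (TCall 12 (TCons (TCdr r2) x2))))
        ttrue)
    (TIf x1
      (foldr (fun y t => TIf (prog_extend y) t TNil) ttrue (enum {: node}))
      ttrue)
    TNil.

Definition prog_exp2 : term := TIf TArg (TCall 15 (TCall 14 r1)) ttrue.
Definition prog_double : term :=
  TIf TArg (TCons TNil (TCons TNil (TCall 15 r1))) TNil.
Definition prog_cat : term :=
  TIf x1 (TCons (TCar x1) (TCall 16 (TCons (TCdr x1) r1))) r1.
Definition prog_size : term :=
  TIf TArg (TCons TNil (TCall 16 (TCons (TCall 17 x1) (TCall 17 r1)))) TNil.

Definition prog : program :=
  [:: prog_main; prog_eq; prog_nth; prog_beval; prog_test; prog_act; prog_or;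
      prog_any; prog_fill; prog_reach; prog_star; prog_last; prog_accepts;
      prog_check; prog_exp2; prog_double; prog_cat; prog_size].

Local Notation computes := (calls prog).
Ltac step := apply: wp_calls => /=.
Ltac call lem := eexists; [exact: lem|] => /=.

Lemma computes_eq s t : computes 1 (SCons s t) (sbool (sexp_eqb s t)).
Proof.
elim: s t => [|a IHa b IHb] [|c d]; step => //.
call IHa; case: (sexp_eqb a c) => //=.
by call IHb.
Qed.

Lemma computes_nth n l : computes 2 (SCons (scode_nat n) (slist l))
  (nth SNil l n).
Proof.
elim: n l => [|n IH] [|a l]; step => //.
- by call (IH [::]); rewrite nth_nil.
- by call IH.
Qed.

Lemma computes_beval (p : bexp Omega) (v : At) :
  computes 3 (SCons (scode_bexp p) (svaluation v)) (sbool (beval v p)).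
Proof.
elim: p => [o|p IHp q IHq|p IHp q IHq|p IHp||]; step => //.
- by call computes_nth; rewrite -map_comp (nth_map o) /= ?nth_enum_rank -?cardE.
- by call IHp; case: (beval v p) => //=; call IHq.
- by call IHp; case: (beval v p) => //=; call IHq.
- by call IHp; case: (beval v p).
Qed.

Lemma computes_test p S om : size S = size om ->
  computes 4 (SCons (scode_bexp p) (SCons (sbits S) (sword om))) (sbits
    (ptest p S om)).
Proof.
elim: S om => [|b S IH] [|y om] //= => [_|[/IH{}IH]]; step => //.
by case: b => /=; [call computes_beval|]; call IH.
Qed.

Lemma slabelE c (a : Sigma) : sexp_eqb (slabel c) (scode_fin a) = (c == Some a).
Proof.
have natI : injective scode_nat by elim=> [|m IH] [|n] //= [/IH->].
apply/sexp_eqP/eqP => [|-> //]; case: c => [b|] /=; last first.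
  by rewrite /scode_fin; case: (nat_of_ord _).
by move=> /natI/val_inj/enum_rank_inj->.
Qed.

Lemma computes_act (a : Sigma) c S om : size S = size om ->
  computes 5 (SCons (scode_fin a) (SCons (sbool c) (SCons (sbits S) (sword om))))
    (sbits (pact a c S om)).
Proof.
elim: S c om => [|b S IH] c [|y om] //= => [_|[/IH{}IH]]; step => //.
case: c => /=; last by call IH.
by call computes_eq; call IH; rewrite slabelE.
Qed.

Lemma computes_or S T : size S = size T ->
  computes 6 (SCons (sbits S) (sbits T)) (sbits (por S T)).
Proof.
elim: S T => [|b S IH] [|c T] //= => [_|[/IH{}IH]]; step => //.
by case: b => /=; call IH.
Qed.

Lemma computes_any S : computes 7 (sbits S) (sbool (has id S)).
Proof. by elim: S => [|b S IH]; step => //; case: b => //=; call IH. Qed.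

Lemma computes_fill (T : Type) b (S : seq T) (g : T -> sexp) :
  computes 8 (SCons (sbool b) (slist (map g S))) (sbits (map (fun=> b) S)).
Proof. by elim: S => [|c S IH]; step => //; call IH. Qed.

(** Correctness for the body is a hypothesis, to be supplied by the induction on expressions in
    [computes_reach]. *)
Lemma computes_star e n S om :
  (forall T, size T = size om ->
    computes 9 (SCons (code e) (SCons (sbits T) (sword om))) (sbits
      (reach e om T))) ->
  size S = size om -> (n <= size om)%N ->
  computes 10 (SCons (sword (drop n om)) (SCons (code e) (SCons (sbits S)
    (sword om))))
    (sbits (pstar (reach e om) (size om - n) S)).
Proof.
move=> He sS le_n.
have [m Em] : exists m, (size om - n)%N = m by exists (size om - n)%N.
rewrite Em; elim: m n le_n Em S sS => [|m IH] n le_n Em S sS.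
  by rewrite drop_oversize; [step|rewrite -subn_eq0 Em].
have lt_n : (n < size om)%N by rewrite -subn_gt0 Em.
have sr : size S = size (reach e om S) by rewrite size_reach.
have sp : size (por S (reach e om S)) = size om by rewrite size_por.
have Em' : size om - n.+1 = m by rewrite subnS Em.
rewrite (drop_nth (node0 Sigma Omega)) //; step.
by call (He _ sS); call (computes_or sr); call (IH n.+1 lt_n Em' _ sp).
Qed.

Lemma computes_reach e S om : size S = size om ->
  computes 9 (SCons (code e) (SCons (sbits S) (sword om))) (sbits (reach e om S)).
Proof.
elim: e S => [||[a|p|]|e IHe f IHf|e IHe f IHf|e IHe] S sS; step => //.
- by call (@computes_fill _ false S sbool).
- by call (@computes_act a false _ _ sS).
- by call (computes_test p sS).
- by call computes_any; call computes_fill.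
- call (IHe _ sS); call (IHf _ sS).
  have sef : size (reach e om S) = size (reach f om S) by rewrite !size_reach.
  by call (computes_or sef).
- by call (IHe _ sS); call (IHf _ (size_reach e sS)).
- have := @computes_star e 0 S om IHe sS (leq0n _); rewrite drop0 subn0 => st.
  by call st.
Qed.

Lemma computes_last S : computes 11 (sbits S) (sbool (last false S)).
Proof.
elim: S => [|b S IH]; step => //; case: S IH => [|c S] IH //=.
by call IH.
Qed.

Lemma computes_accepts e y om :
  computes 12 (SCons (code e) (sword (y :: om))) (sbool (paccepts e (y :: om))).
Proof.
step; call (@computes_fill _ false om snode_code).
have sS : size (true :: map (fun=> false) om) = size (y ::
  om) by rewrite /= size_map.
by call (computes_reach e sS); call computes_last.
Qed.

Fixpoint agree e f (n : nat) om : bool :=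
  (nilp om || (paccepts e om == paccepts f om)) &&
  (if n is n.+1 then all (fun y => agree e f n (y :: om)) (enum {:
    node}) else true).

Lemma agreeP e f n om : reflect
  (forall u, (size u <= n)%N -> u ++ om <> [::] ->
    paccepts e (u ++ om) = paccepts f (u ++ om)) (agree e f n om).
Proof.
elim: n om => [|n IH] om /=.
  rewrite andbT; apply: (iffP idP) => [ok [|//] _ /=|ok].
    by move: ok => /orP[/nilP->|/eqP].
  by apply/orP; case: om ok => [|y om] ok; [left|right; apply/eqP;
    exact: (ok [::])].
apply: (iffP andP) => [[ok /allP ext] u|ok].
  (* Words grow on the left, so the node added by the first recursive call is the last one of
     [u]. *)
  case/lastP: u => [_|u y]; first by move: ok => /orP[/nilP->|/eqP].
  rewrite size_rcons cat_rcons => le_u _; apply: (elimT (IH _) (ext y _)) => //.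
    by rewrite mem_enum.
  by case: (u).
split; last first.
  apply/allP => y _; apply/IH => u le_u _; rewrite -cat_rcons.
  by apply: ok; rewrite ?size_rcons //; case: (u).
by apply/orP; case: om ok => [|y om] ok; [left|right; apply/eqP;
  exact: (ok [::])].
Qed.

Lemma sexp_eqb_bool b c : sexp_eqb (sbool b) (sbool c) = (b == c).
Proof. by case: b; case: c. Qed.

Lemma computes_check e f n om :
  computes 13 (SCons (scode_nat n) (SCons (sword om) (SCons (code e) (code f))))
    (sbool (agree e f n om)).
Proof.
elim: n om => [|n IH] om; step.
  case: om => [|y om] //=.
  call computes_accepts; call computes_accepts; call computes_eq.
  by rewrite sexp_eqb_bool; case: (_ == _).
(* The unrolled loop is treated for an arbitrary list of nodes, by a separate induction. *)
have loop l : wp prog (SCons (scode_nat n.+1) (SCons (sword om) (SCons (code e)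
  (code f))))
    (foldr (fun y t => TIf (prog_extend y) t TNil) ttrue l)
    (eq^~ (sbool (all (fun y => agree e f n (y :: om)) l))).
  elim: l => //= y l IHl; do 2!apply: wp_quote => /=.
  by call (IH (y :: om)); case: (agree _ _ _ _).
case: om loop => [|y om] loop /=; first exact: loop.
call computes_accepts; call computes_accepts; call computes_eq.
by rewrite sexp_eqb_bool; case: (_ == _) => //=; exact: loop.
Qed.

Lemma computes_double n : computes 15 (scode_nat n) (scode_nat n.*2).
Proof. by elim: n => [|n IH]; step => //; call IH. Qed.

Lemma computes_exp2 n : computes 14 (scode_nat n) (scode_nat (2 ^ n)).
Proof.
elim: n => [|n IH]; step => //; call IH; call computes_double.
by rewrite expnS mul2n.
Qed.

Lemma computes_cat m n : computes 16 (SCons (scode_nat m) (scode_nat n))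
  (scode_nat (m + n)).
Proof. by elim: m => [|m IH]; step => //; call IH. Qed.

Lemma computes_size s : computes 17 s (scode_nat (ssize s)).
Proof.
by elim: s => [|a IHa b IHb]; step => //; call IHa; call IHb; call computes_cat.
Qed.

Lemma rsize_code e : (rsize e <= ssize (code e))%N.
Proof.
elim: e => [||a|e IHe f IHf|e IHe f IHf|e IHe] /=; rewrite ?addn0 ?addnS ?ltnS //.
- by do 2!apply: leqW; apply: leq_trans (leq_addl _ _); exact: leq_add.
- by do 2!apply: leqW; apply: leq_trans (leq_addl _ _); exact: leq_add.
- exact: leq_trans (leq_addl _ _).
Qed.

(** The computed bound [N] dominates [pairs_bound], which settles one direction; overshooting is
    harmless in the other, since derivably equal expressions agree on models of every size. *)
Theorem prog_decides e f :
  (KA (@H_katf Sigma Omega) e f -> computes_to prog (SCons (code e) (code f))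
    (sbool true)) /\
  (~ KA (@H_katf Sigma Omega) e f ->
    computes_to prog (SCons (code e) (code f)) (sbool false)).
Proof.
set x := SCons (code e) (code f).
pose N := (2 ^ (2 ^ (#|Omega| + 3 + (ssize x + ssize x))))%N.
(* The size of the input is abstracted to [m], which stays opaque to simplification. *)
have main m : computes 17 x (scode_nat m) -> computes_to prog x
    (sbool (agree e f (2 ^ (2 ^ (#|Omega| + 3 + (m + m)))) [::])).
  move=> size_x; apply: eval_call (eval_arg _ _) _; apply: wp_calls => /=.
  apply: wp_quote; call size_x; call size_x; call computes_cat; call computes_cat.
  call computes_exp2; call computes_exp2.
  by call (@computes_check e f (2 ^ (2 ^ (#|Omega| + 3 + (m + m)))) [::]).
have {}main := main _ (computes_size x).
have le_N : (pairs_bound Omega (rsize e + rsize f) <= N)%N.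
  rewrite !leq_exp2l // leq_add2l; have := leq_add (rsize_code e) (rsize_code f).
  by move=> le_ef; apply: leq_add; rewrite /= leqW.
have agreeE : agree e f N [::] <-> KA (@H_katf Sigma Omega) e f.
  split=> [/agreeP ag|ef].
    apply/KA_bounded => om om0 le_om; rewrite -!paccepts_accepts // -[om]cats0.
    by rewrite ag ?cats0 //; exact: leq_trans le_om le_N.
  apply/agreeP => u _; rewrite cats0 => u0; apply/idP/idP;
    rewrite !paccepts_accepts //.
    by case: u u0 => [//|[c v] s] _; rewrite !accepts_label;
      move/KA_accepts: ef => ->.
  by case: u u0 => [//|[c v] s] _; rewrite !accepts_label;
    move/KA_accepts: ef => ->.
split=> [/agreeE ef|nef]; first by rewrite -ef.
by rewrite -(introF idP (fun ag => nef (agreeE.1 ag))).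
Qed.

End Program.

Theorem theorem7p5 (Sigma Omega : finType) :
  reduces_to_empty (@H_katf Sigma Omega) /\
  complete (@H_katf Sigma Omega) /\
  decidable_rel (scode_regex (@scode_letter Sigma Omega))
                (KA (@H_katf Sigma Omega)).
Proof.
split; first exact: H_katf_reduces.
split; first exact: H_katf_complete.
by exists (prog Sigma Omega) => e f; exact: prog_decides.
Qed.
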